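(* Let $F=F(a,b)$ be a free group of rank two with free basis $A=\{a,b\}$. Then for the set $\mathcal{T}$ of all test elements in $F$ the strict annular density exists and $$\sigma_A(\mathcal{T})=1-\frac{6}{\pi^2}.$$ Moreover, $$0<\frac49\left(1-\frac{6}{\pi^2}\right)\le\liminf_{n\to\infty}\frac{\rho_A(n,\mathcal{T})}{\rho_A(n,F)}\le\limsup_{n\to\infty}\frac{\rho_A(n,\mathcal{T})}{\rho_A(n,F)}\le 1-\frac{8}{3\pi^2}<1.$$
   Context: An element $g$ of a group $G$ is a test element if every endomorphism of $G$ which fixes $g$ is an automorphism of $G$. For $w\in F$, $|w|_A$ is the freely reduced length of $w$ with respect to $A$. For $X\subseteq F$ and $n\ge 0$, $\gamma_A(n,X)=\#\{w\in X:|w|_A=n\}$ and $\rho_A(n,X)=\#\{w\in X:|w|_A\le n\}$. The strict annular density of $X\subseteq F$ is $$\sigma_A(X)=\lim_{n\to\infty}\frac12\left(\frac{\gamma_A(n-1,X)}{\gamma_A(n-1,F)}+\frac{\gamma_A(n,X)}{\gamma_A(n,F)}\right),$$ provided this limit exists. *)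

(* Defs.v *)
(* MathComp / MathComp-Analysis *)
From HB Require Import structures.
From mathcomp Require Import all_boot all_order all_algebra finmap.
From mathcomp Require Import all_classical all_reals all_analysis.

Set Implicit Arguments.
Unset Strict Implicit.
Unset Printing Implicit Defensive.

Import Order.TTheory GRing.Theory Num.Theory.
Import numFieldNormedType.Exports.

Local Open Scope classical_set_scope.
Local Open Scope ring_scope.

Section FreeGroup.
Variable X : choiceType.

(* (x, true) is the letter x and (x, false) is the letter x^-1. *)
Local Notation letter := (X * bool)%type.

Definition linv (l : letter) : letter := (l.1, ~~ l.2).

Lemma linvK : involutive linv.
Proof. by case=> x b; rewrite /linv /= negbK. Qed.

Definition reduced (s : seq letter) : bool := sorted (fun l m => m != linv l) s.

Record freegroup := FreeWord { fword :> seq letter; fwordP : reduced fword }.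

HB.instance Definition _ := [isSub for fword].
HB.instance Definition _ := [Choice of freegroup by <:].

(* Left multiplication of a reduced word by a letter, with cancellation. *)
Definition lmul (l : letter) (s : seq letter) : seq letter :=
  if s is m :: s' then if m == linv l then s' else l :: s else [:: l].

Lemma lmul_reduced l s : reduced s -> reduced (lmul l s).
Proof.
case: s => [|m s] //= ms; case: ifP => [_|ml]; first exact: path_sorted ms.
by rewrite /= ml ms.
Qed.

Lemma lmulK l s : reduced s -> lmul (linv l) (lmul l s) = s.
Proof.
case: s => [|m s] /= ms; first by rewrite linvK eqxx.
case: eqP => [-> {m}|/eqP ml] in ms *; last by rewrite /= linvK eqxx.
by case: s ms => [|k s] //= /andP[/negbTE kl _]; rewrite kl.
Qed.

Lemma lmul_cons l s : reduced (l :: s) -> lmul l s = l :: s.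
Proof. by case: s => [|m s] //= /andP[/negbTE->]. Qed.

Definition wmul (s t : seq letter) : seq letter := foldr lmul t s.

Lemma wmul_reduced s t : reduced t -> reduced (wmul s t).
Proof. by move=> rt; elim: s => //= l s; exact: lmul_reduced. Qed.

Lemma wmul_nil s : reduced s -> wmul s [::] = s.
Proof.
elim: s => //= l s IH rs.
by rewrite (IH (path_sorted rs)); exact: lmul_cons.
Qed.

Lemma wmul_lmul l s t :
  reduced s -> reduced t -> wmul (lmul l s) t = lmul l (wmul s t).
Proof.
case: s => [|m s] //= rs rt; case: eqP => //= -> {m rs}.
by have := lmulK (linv l) (wmul_reduced s rt); rewrite linvK => ->.
Qed.

Lemma wmulA s t u :
  reduced t -> reduced u -> wmul s (wmul t u) = wmul (wmul s t) u.
Proof.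
move=> rt ru; elim: s => //= l s ->.
by rewrite wmul_lmul// wmul_reduced.
Qed.

Definition winv (s : seq letter) : seq letter := rev (map linv s).

Lemma winvK : involutive winv.
Proof. by move=> s; rewrite /winv map_rev revK (mapK linvK). Qed.

Lemma winv_reduced s : reduced s -> reduced (winv s).
Proof.
rewrite /reduced /winv rev_sorted sorted_map; apply: sub_sorted => l m /=.
by apply: contraNneq => ->; rewrite linvK.
Qed.

Lemma wmulV s t : reduced t -> wmul (winv s) (wmul s t) = t.
Proof.
move=> rt; elim: s => //= l s IH.
rewrite /winv /= rev_cons /wmul foldr_rcons lmulK; first exact: IH.
exact: wmul_reduced.
Qed.

Definition fmul (u v : freegroup) : freegroup :=
  FreeWord (wmul_reduced u (fwordP v)).
Definition finv (u : freegroup) : freegroup :=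
  FreeWord (winv_reduced (fwordP u)).
Definition fone : freegroup := @FreeWord [::] isT.

Lemma fmulA : associative fmul.
Proof. by move=> u v w; apply: val_inj; apply: wmulA; apply: fwordP. Qed.
Lemma fmul1 : left_id fone fmul.
Proof. by move=> u; apply: val_inj. Qed.
Lemma fmulr1 : right_id fone fmul.
Proof. by move=> u; apply: val_inj; apply: wmul_nil; apply: fwordP. Qed.
Lemma fmulV : left_inverse fone finv fmul.
Proof.
move=> u; apply: val_inj => /=.
by have := @wmulV u [::] isT; rewrite (wmul_nil (fwordP u)).
Qed.
Lemma fmulrV : right_inverse fone finv fmul.
Proof.
move=> u; rewrite -[X in fmul X _](_ : finv (finv u) = u) ?fmulV//.
by apply: val_inj; apply: winvK.
Qed.

HB.instance Definition _ :=
  isGroup.Build freegroup fmulA fmul1 fmulr1 fmulV fmulrV.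

Definition fgen (x : X) : freegroup := @FreeWord [:: (x, true)] isT.

(* [fgen] is a free basis of [freegroup]. *)
Section UniversalProperty.
Local Open Scope group_scope.
Variables (H : groupType) (h : X -> H).

Definition leval (l : letter) : H := if l.2 then h l.1 else (h l.1)^-1.
Definition weval (s : seq letter) : H := foldr (fun l z => leval l * z) 1 s.

Lemma leval_linv l : leval (linv l) = (leval l)^-1.
Proof. by case: l => x [] //=; rewrite /leval /= invgK. Qed.

Lemma weval_lmul l s : weval (lmul l s) = leval l * weval s.
Proof.
by case: s => [|m s] //=; case: eqP => //= ->; rewrite leval_linv mulVKg.
Qed.

Lemma weval_wmul s t : weval (wmul s t) = weval s * weval t.
Proof. by elim: s => /= [|l s IH]; rewrite ?mul1g// weval_lmul IH mulgA. Qed.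

Lemma freegroup_universal :
  exists f : {multiplicative freegroup -> H}, (forall x, f (fgen x) = h x) /\
    forall g : {multiplicative freegroup -> H},
      (forall x, g (fgen x) = h x) -> g =1 f.
Proof.
pose f0 (u : freegroup) := weval u.
have f0M : {morph f0 : u v / u * v} by move=> u v; exact: weval_wmul.
pose fM := isMultiplicative.Build freegroup H f0 f0M.
pose f : {multiplicative freegroup -> H} := HB.pack f0 fM.
exists f; split=> [x|g gh [s rs]] /=; first by rewrite /f0 /= /leval /= mulg1.
have gM u v : g (u * v) = g u * g v by exact: gmulfM.
have g1 : g 1 = 1 by apply: (mulgI (g 1)); rewrite -gM !mulg1.
have gV u : g u^-1 = (g u)^-1.
  by apply: (mulgI (g u)); rewrite -gM !mulgV g1.
elim: s rs => [|l s IH] rs.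
  by rewrite (_ : FreeWord rs = 1) ?g1//; apply: val_inj.
have rs' : reduced s := path_sorted rs.
pose lw : freegroup := @FreeWord [:: l] isT.
have e : FreeWord rs = lw * FreeWord rs'.
  by apply: val_inj => /=; rewrite lmul_cons.
rewrite [in LHS]e gM IH /f0 /=; congr (_ * _).
case: l @lw {rs e} => x [] lw; rewrite /leval /= -gh//.
by rewrite -gV; congr (g _); apply: val_inj.
Qed.

End UniversalProperty.
End FreeGroup.

Definition test_element (G : groupType) (g : G) : Prop :=
  forall f : {multiplicative G -> G}, f g = g -> bijective f.

Definition test_elements (G : groupType) : set G := [set g | test_element g].
Arguments test_elements : clear implicits.

(* Elements of [freegroup X] are freely reduced words, so the length with
   respect to the basis X is the size of the underlying sequence. *)
Definition flen (X : choiceType) (w : freegroup X) : nat := size (fword w).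

(* The sets counted below are finite ([finite_ball]); [fset_set] would return
   the empty set on an infinite one. *)
Definition sphere_card (X : finType) (n : nat) (S : set (freegroup X)) : nat :=
  #|` fset_set [set w | S w /\ flen w = n] |.

Definition ball_card (X : finType) (n : nat) (S : set (freegroup X)) : nat :=
  #|` fset_set [set w | S w /\ (flen w <= n)%N] |.

Lemma finite_ball (X : finType) (n : nat) (S : set (freegroup X)) :
  finite_set [set w | S w /\ (flen w <= n)%N].
Proof.
have fin m : finite_set [set s : seq (X * bool) | (size s <= m)%N].
  elim: m => [|m IH].
    by apply: (@sub_finite_set _ _ [set [::]]) => // -[].
  apply: (@sub_finite_set _ _ ([set [::]] `|`
    (fun p => p.1 :: p.2) @` ([set: X * bool] `*`
      [set s : seq (X * bool) | (size s <= m)%N]))).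
    by case=> [|l s] /= sm; [left | right; exists (l, s)].
  rewrite finite_setU; split=> //.
  by apply/finite_image/finite_setX => //; exact: finite_finset.
apply: (@sub_finite_set _ _ (@fword X @^-1`
  [set s : seq (X * bool) | (size s <= n)%N])); first by move=> w [].
by apply: finite_preimage (fin n) => u v _ _; exact: val_inj.
Qed.

Section Density.
Variable R : realType.
Variable X : finType.
Implicit Type S : set (freegroup X).

Definition sphere_ratio S (n : nat) : R :=
  (sphere_card n S)%:R / (sphere_card n [set: freegroup X])%:R.

Definition ball_ratio S (n : nat) : R :=
  (ball_card n S)%:R / (ball_card n [set: freegroup X])%:R.

(* The index n.-1 is the junk value 0 when n = 0, which does not affect the
   limit. *)
Definition annular_ratio S (n : nat) : R :=
  2^-1 * (sphere_ratio S n.-1 + sphere_ratio S n).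

Definition has_strict_annular_density S (l : R) : Prop :=
  annular_ratio S n @[n --> \oo] --> l.

End Density.

(* Main.v *)
(* Call a word visible if the exponents of its abelianization are coprime. A
   visible g is not a test element: a Bezout relation yields an endomorphism with
   image <g> fixing g. Conversely let f fix g and not be bijective. Nielsen
   reduction of the generators of each image f^n(F) leaves two possibilities. Either
   g is for some n a power of one reduced generator; then g is visible or a proper
   power. Or g involves both generators for every n; then their lengths are
   bounded by that of g, so f^n(F) = f^m(F) for some n < m, and f, which is then
   injective, is onto. Since proper powers are exponentially rare, the test
   elements have the density of the non-visible words.

   For a character of Z^2 with angles alpha, beta, put t = 2 cos alpha + 2 cos beta.
   The sums S_n of the character over the reduced words of length n satisfy
   S_(n+1) = t S_n - 3 S_(n-1), hence are of order 3^n exp (- c n (16 - t^2)).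
   Finite Fourier analysis mod d then gives annular density 1/d^2 to the words whose
   abelianization is divisible by d, with the uniform bound O(1/d^2 + 1/n) for odd d.
   Together with a second moment bound this makes the sieve over primes converge
   to prod (1 - 1/p^2) = 6/pi^2. The bounds for balls follow from the annular
   densities of the test elements and of their complement by keeping the last
   two spheres of each ball. *)

Require Import Defs.
From HB Require Import structures.
From mathcomp Require Import all_boot all_order all_algebra finmap.
From mathcomp Require Import all_classical all_reals all_analysis.
From mathcomp Require Import zify ring lra.

Set Implicit Arguments.
Unset Strict Implicit.
Unset Printing Implicit Defensive.

Import Order.TTheory GRing.Theory Num.Theory.
Import numFieldNormedType.Exports.

Local Open Scope classical_set_scope.
Local Open Scope ring_scope.

(** * Nielsen reduction *)

Section CommonPrefix.
Variable T : eqType.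
Implicit Types s t u : seq T.

Fixpoint lcp s t : nat :=
  match s, t with
  | x :: s', y :: t' => if x == y then (lcp s' t').+1 else 0%N
  | _, _ => 0%N
  end.

Lemma lcpC s t : lcp s t = lcp t s.
Proof. by elim: s t => [|x s IH] [|y t] //=; rewrite eq_sym IH. Qed.

(** Words are vertices of a rooted tree and [lcp s t] is the depth at which two of them branch,
    whence the ultrametric inequality. *)
Lemma lcp_ultra s t u : (minn (lcp s t) (lcp t u) <= lcp s u)%N.
Proof.
elim: s t u => [|x s IH] [|y t] [|z u] //=; rewrite ?minn0 ?min0n//.
case: eqP => [->|_]; last by rewrite min0n.
by case: eqP => _; rewrite ?minn0// minnSS ltnS.
Qed.

End CommonPrefix.

(** * Cancellation, Gromov products and powers of reduced words *)

Section Gromov.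
Variable X : choiceType.
Local Notation F := (freegroup X).
Implicit Types (u v w : F) (s t : seq (X * bool)).

Lemma winv_cons (l : X * bool) s : winv (l :: s) = rcons (winv s) (linv l).
Proof. by rewrite /winv /= rev_cons. Qed.

(** The common prefix is exactly what cancels in s^-1 t: [dj] treats words with no common prefix,
    and the induction strips equal first letters. *)
Lemma size_wmul_winv s t : reduced s -> reduced t ->
  (size (wmul (winv s) t) + (lcp s t).*2 = size s + size t)%N.
Proof.
have dj : forall s t, reduced s -> reduced t -> lcp s t = 0%N ->
    size (wmul (winv s) t) = (size s + size t)%N.
  elim=> [//|l {}s IH] {}t rs rt h; rewrite winv_cons /wmul foldr_rcons.
  have -> : lmul (linv l) t = linv l :: t.
    case: t rt h => //= m t _; rewrite linvK.
    by case: eqVneq => // ->; rewrite eqxx.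
  rewrite -/(wmul _ _) IH /= ?addnS//; first exact: path_sorted rs.
    case: t rt h => //= m t rt; rewrite /reduced /= rt andbT linvK.
    by case: eqVneq => // ->; rewrite eqxx.
  case: s rs {IH h} => //= k s /andP[kl _].
  by rewrite (negbTE kl).
elim: s t => [|l s IH] t rs rt; first by rewrite /= addn0.
case: t rt => [|m t] rt; first by rewrite dj //= !addn0.
rewrite /=; have [lm|lm] := eqVneq l m; last first.
  by rewrite dj ?addn0//= (negbTE lm).
have := IH t (path_sorted rs) (path_sorted rt).
by rewrite winv_cons /wmul foldr_rcons /= linvK lm eqxx; lia.
Qed.

(* Twice the Gromov product of [u] and [v]. *)
Definition gp u v : nat := (lcp (fword u) (fword v)).*2.

Lemma gpE u v w : (u * w)%g = v -> (flen w + gp u v = flen u + flen v)%N.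
Proof.
move=> uw; have -> : w = (u^-1 * v)%g by rewrite -uw mulKg.
exact: size_wmul_winv (fwordP u) (fwordP v).
Qed.

Lemma gpC u v : gp u v = gp v u. Proof. by rewrite /gp lcpC. Qed.

Lemma gp_ultra u v w : (minn (gp u v) (gp v w) <= gp u w)%N.
Proof. by have := lcp_ultra (fword u) (fword v) (fword w); rewrite /gp; lia. Qed.

Lemma flenV u : flen u^-1%g = flen u.
Proof. by rewrite /flen /= /winv size_rev size_map. Qed.

Lemma flen_eq0 u : (flen u == 0%N) = (u == 1%g).
Proof. by rewrite /flen size_eq0; apply/eqP/eqP => [h|->//]; apply: val_inj. Qed.

Lemma linv_neq (l : X * bool) : linv l != l.
Proof. by case: l => x [] /=; rewrite /linv xpair_eqE eqxx. Qed.

Lemma wmul_cat s t : reduced (s ++ t) -> wmul s t = s ++ t.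
Proof.
elim: s => //= l s IH rs.
by rewrite IH; [exact: lmul_cons | exact: path_sorted rs].
Qed.

Lemma reduced_cat s t : reduced (s ++ t) =
  [&& reduced s, reduced t & if s is x :: s' then
     if t is y :: _ then y != linv (last x s') else true else true].
Proof.
case: s => [|x s]; first by rewrite andbT.
case: t => [|y t]; first by rewrite cats0 !andbT.
by rewrite /reduced /= cat_path /=; congr (_ && _); rewrite andbC.
Qed.

(** As long as the first and last letters are mutually inverse, they are moved into the conjugator
    [c]. The condition on [r ++ r] says that [r] is cyclically reduced. *)
Lemma cyclic_decomposition s : reduced s -> s != [::] ->
  exists c r, [/\ s = c ++ r ++ winv c, reduced (r ++ r) & r != [::]].
Proof.
have [n] := ubnP (size s); elim: n s => // n IH [//|l s] sn rs _.
have [m e] : {m | last l s = m} by exists (last l s).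
have [ml|ml] := eqVneq l (linv m); last first.
  exists [::], (l :: s); split=> //; first by rewrite /= cats0.
  by rewrite reduced_cat rs /= e.
case/lastP: s => [|s k] in sn rs e *.
  by have := linv_neq m; rewrite -ml -e /= eqxx.
rewrite last_rcons in e; rewrite {k}e {l}ml in sn rs *.
have ls : s != [::].
  by case: s rs {sn} => //=; rewrite linvK eqxx.
have rs' : reduced s.
  by move: (path_sorted rs); rewrite -cats1 -/(reduced _) reduced_cat => /and3P[].
have [|c [r [-> rr r0]]] := IH s _ rs' ls.
  by move: sn; rewrite /= size_rcons; lia.
exists (linv m :: c), r; split => //.
by rewrite winv_cons linvK -!cats1 /= !catA.
Qed.

Lemma reduced_glue s t (d : seq (X * bool)) : t != [::] -> reduced (s ++ t) -> reduced (t ++ d) ->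
  reduced (s ++ t ++ d).
Proof.
by case: t => // y t _; rewrite !reduced_cat => /and3P[-> _ ->] /and3P[-> -> ->].
Qed.

(** In (c r c^-1)^k the inner conjugators disappear, and copies of the cyclically reduced [r]
    concatenate without cancellation. *)
Lemma power_decomposition u : u != 1%g ->
  exists c r, [/\ r != [::], fword u = c ++ r ++ winv c &
    forall k, (0 < k)%N ->
      fword (u ^+ k)%g = c ++ flatten (nseq k r) ++ winv c].
Proof.
move=> u1.
have [|c [r [e rr r0]]] := cyclic_decomposition (fwordP u).
  by rewrite -size_eq0 -/(flen u) flen_eq0.
exists c, r; split => // -[//|k] _.
have := fwordP u; rewrite e => rcrv.
have rrv : reduced (r ++ winv c) by move: rcrv; rewrite reduced_cat => /and3P[].
have rcr : reduced (c ++ r).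
  by move: rcrv; rewrite catA reduced_cat => /and3P[].
have [rc r'] : reduced c /\ reduced r by move: rcr; rewrite reduced_cat => /and3P[].
have rflat (v : seq (X * bool)) j : reduced (r ++ v) -> reduced (flatten (nseq j.+1 r) ++ v).
  move=> rv; elim: j => [|j IH]; first by rewrite /= cats0.
  by rewrite /= -!catA; apply: reduced_glue => //; move: IH; rewrite /= catA.
pose C := FreeWord rc; pose Q := FreeWord r'.
have uE : u = (C * (Q * C^-1))%g.
  by apply: val_inj; rewrite /= e [wmul r _]wmul_cat// wmul_cat.
have uk : (u ^+ k.+1 = C * (Q ^+ k.+1 * C^-1))%g.
  elim: k => [|k IH]; first by rewrite !expg1.
  by rewrite expgS IH [(Q ^+ k.+2)%g]expgS uE !mulgA mulgVK.
have Qk j : fword (Q ^+ j)%g = flatten (nseq j r).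
  elim: j => // j IH; rewrite expgS /= IH wmul_cat//.
  by have := rflat [::] j; rewrite !cats0; apply.
rewrite uk /= Qk [wmul (flatten _) _]wmul_cat; last exact: rflat.
rewrite wmul_cat// /= -!catA; apply: reduced_glue => //.
by have := rflat _ k rrv; rewrite /= catA.
Qed.

Lemma flen_sq u : u != 1%g -> (flen u < flen (u * u)%g)%N.
Proof.
move=> /power_decomposition[c [r [r0 e h]]].
rewrite -expg2 /flen (h 2 isT) e /= cats0 !size_cat.
by case: r r0 {e h} => //= *; lia.
Qed.

End Gromov.

(** * Nielsen reduced families *)

Section NielsenReduced.
Variable X : choiceType.
Local Notation F := (freegroup X).
Implicit Types (h : X -> F) (l m : X * bool).

(** Nielsen's conditions in terms of doubled common prefixes: at most half of a generator cancels
    against one neighbour, and two neighbours together never cancel all of it. *)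
Definition nielsen_reduced h :=
  (forall l m, l != m -> (gp (leval h l) (leval h m) <= flen (leval h m))%N) /\
  (forall l s z, s != l -> z != linv l ->
    (gp (leval h s) (leval h l) + gp (leval h (linv l)) (leval h z)
      < (flen (leval h l)).*2)%N).

(* By the ultrametric inequality, multiplying by further letters does not change
   the Gromov product with the first one. *)
Lemma nielsen_reduced_weval h m s : nielsen_reduced h -> reduced (m :: s) ->
  [/\ forall l, l != m ->
        gp (leval h l) (weval h (m :: s)) = gp (leval h l) (leval h m),
      (flen (leval h m) <= flen (weval h (m :: s)))%N &
      (flen (weval h s) <= flen (weval h (m :: s)))%N].
Proof.
case=> N1 N2; elim: s m => [|k s IH] m.
  by move=> _; rewrite /= mulg1; split.
move=> /= /andP[km rs]; have [IH1 IH2 IH3] := IH k rs.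
set W' := weval h (k :: s) in IH1 IH2 IH3 *.
rewrite -/W'; set u := leval h m; set W := (u * W')%g.
have mk : linv m != k by rewrite eq_sym.
have : (leval h (linv m) * W)%g = W' by rewrite leval_linv mulKg.
move=> /gpE e1; rewrite (IH1 _ mk) leval_linv -/u flenV in e1.
have n1 := N1 _ _ mk; rewrite leval_linv -/u in n1.
have := N1 _ _ (_ : k != linv m); rewrite leval_linv -/u flenV => /(_ km) n2.
rewrite gpC in n2.
have W1 : (flen u <= flen W)%N by lia.
have W2 : (flen W' <= flen W)%N by lia.
split=> // l lm.
have e2 := @gpE _ u W W' erefl.
have := N2 m l k lm km; rewrite leval_linv -/u => n3.
have u1 := gp_ultra (leval h l) u W.
have u2 := gp_ultra (leval h l) W u.
rewrite (gpC W u) in u2; lia.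
Qed.

(** This bounds the length of each generator that occurs in a fixed word by the length of that word,
    so that only finitely many reduced pairs come into question. *)
Lemma flen_letter_le h s m : nielsen_reduced h -> reduced s -> m \in s ->
  (flen (leval h m) <= flen (weval h s))%N.
Proof.
move=> N; elim: s => // l s IH rs; rewrite inE.
have [_ h1 h2] := nielsen_reduced_weval N rs.
case/predU1P => [->//|ms]; apply: leq_trans h2; apply: IH => //.
exact: path_sorted rs.
Qed.

Lemma nielsen_reduced_neq1 h (w : F) : nielsen_reduced h -> w != 1%g ->
  weval h (fword w) != 1%g.
Proof.
move=> N w1; have := fwordP w.
have : fword w != [::] by rewrite -size_eq0 -/(flen w) flen_eq0.
case: (fword w) => // m s _ rs; have [_ h1 _] := nielsen_reduced_weval N rs.
rewrite -flen_eq0 -lt0n; apply: leq_trans h1.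
(* The second condition for the product m m m shows that the value of [m] has positive length. *)
have := N.2 m (linv m) m; rewrite linv_neq eq_sym linv_neq => /(_ isT isT).
by lia.
Qed.

End NielsenReduced.

Section HalfFree.
Variable X : choiceType.
Local Notation F := (freegroup X).
Implicit Types x y : F.

(* A letter cancels at most half of each neighbour, and its two neighbours never
   cancel both of its halves. *)
Definition half_free x y : Prop :=
  [/\ (gp x y <= minn (flen x) (flen y))%N,
      (gp x y^-1%g <= minn (flen x) (flen y))%N,
      (gp x^-1%g y <= minn (flen x) (flen y))%N &
      (gp x^-1%g y^-1%g <= minn (flen x) (flen y))%N] /\
  [/\ ((gp x y < flen y)%N && (gp x^-1%g y < flen y)%N ||
       (gp x y^-1%g < flen y)%N && (gp x^-1%g y^-1%g < flen y)%N),
      ((gp x y < flen x)%N && (gp x y^-1%g < flen x)%N ||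
       (gp x^-1%g y < flen x)%N && (gp x^-1%g y^-1%g < flen x)%N),
      x != 1%g & y != 1%g].

(** If half of [x] cancelled in x x, the square would be no longer than [x]. *)
Lemma gp_inv_lt x : x != 1%g -> (gp x x^-1%g < flen x)%N.
Proof.
move=> /flen_sq; have /gpE : (x^-1 * (x * x))%g = x by rewrite mulKg.
by rewrite flenV gpC; lia.
Qed.

Lemma half_free_reduced (h : X -> F) (a b : X) : a != b ->
  (forall i, i = a \/ i = b) -> half_free (h a) (h b) -> nielsen_reduced h.
Proof.
move=> ab cover [[h1 h2 h3 h4] [h5 h6 x1 y1]].
have letters (l : X * bool) :
    [\/ l = (a, true), l = (a, false), l = (b, true) | l = (b, false)].
  by case: l => i []; case: (cover i) => ->; [exact: Or41|exact: Or43|exact: Or42|exact: Or44].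
have hx := gp_inv_lt x1; have hy := gp_inv_lt y1.
have cx := gpC (h a)^-1%g (h a); have cy := gpC (h b)^-1%g (h b).
have c1 := gpC (h b) (h a); have c2 := gpC (h b)^-1%g (h a).
have c3 := gpC (h b) (h a)^-1%g; have c4 := gpC (h b)^-1%g (h a)^-1%g.
have ea : leval h (a, true) = h a by []. have eA : leval h (a, false) = (h a)^-1%g by [].
have eb : leval h (b, true) = h b by []. have eB : leval h (b, false) = (h b)^-1%g by [].
split=> [l m|l s z].
  case: (letters l) => ->; case: (letters m) => ->; rewrite ?eqxx// => _;
  by rewrite ?ea ?eA ?eb ?eB ?flenV; lia.
case: (letters l) => ->; case: (letters s) => ->; rewrite ?eqxx// => _;
case: (letters z) => ->; rewrite /linv /= ?eqxx// => _;
by rewrite ?ea ?eA ?eb ?eB ?flenV; lia.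
Qed.

End HalfFree.

(** * Reduction of a pair, for a property [P] stable under elementary Nielsen moves *)

Section NielsenReduction.
Variable X : choiceType.
Local Notation F := (freegroup X).
Implicit Types x y : F.
Variable P : F -> F -> Prop.
Hypothesis Pswap : forall x y, P x y -> P y x.
Hypothesis Pinv : forall x y, P x y -> P x^-1%g y.
Hypothesis Pmul : forall x y, P x y -> P (x * y)%g y.

Definition minimal_pair x y :=
  P x y /\ forall x' y', P x' y' -> (flen x + flen y <= flen x' + flen y')%N.

Lemma minimal_swap x y : minimal_pair x y -> minimal_pair y x.
Proof.
by case=> Pxy m; split=> [|x' y' /Pswap/m]; [exact: Pswap | rewrite addnC (addnC (flen y'))].
Qed.

Lemma minimal_inv x y : minimal_pair x y -> minimal_pair x^-1%g y.
Proof. by case=> Pxy m; split=> [|x' y']; [exact: Pinv | rewrite flenV; exact: m]. Qed.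

Lemma minimal_le_mul x y w : minimal_pair x y -> (x * y)%g = w ->
  (flen x <= flen w)%N.
Proof. by case=> Pxy /(_ _ _ (Pmul Pxy)) + <-; rewrite leq_add2r. Qed.

(** If more than half of [y] cancelled in x^-1 y, this product would be shorter than [x] and could
    replace it; the other half of the bound is symmetric. *)
Lemma minimal_gp x y : minimal_pair x y -> (gp x y <= minn (flen x) (flen y))%N.
Proof.
move=> mxy; pose w : F := (x^-1 * y)%g.
have /gpE e : (x * w)%g = y by rewrite mulVKg.
have := minimal_le_mul (minimal_inv (minimal_swap mxy)) (_ : _ = w^-1%g).
have := minimal_le_mul (minimal_inv mxy) (_ : _ = w).
rewrite !flenV => /(_ erefl) h1; rewrite invgM invgK => /(_ erefl) h2; lia.
Qed.

(* If both halves of [y] can be cancelled, then [y = p q^-1] and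
   [x = q r p^-1]; in [y x = p r p^-1] the factor [q] has disappeared. *)
Lemma minimal_half_free x y : minimal_pair x y -> x != 1%g -> y != 1%g ->
  gp x^-1%g y = flen y -> gp x y^-1%g = flen y ->
  P (y * x)%g y /\ half_free (y * x)%g y.
Proof.
move=> mxy x1 y1 hA hB.
pose z : F := (y * x)%g; have Pyx : P z y.
  (* Left multiplication comes from right multiplication by inversion: y x = (x^-1 y^-1)^-1. *)
  have := Pinv (Pswap (Pinv (Pswap (Pmul (Pinv (Pswap (Pinv (Pswap mxy.1)))))))).
  by rewrite invgM !invgK.
have /gpE e1 : (y^-1 * z)%g = x by rewrite mulKg.
rewrite flenV gpC hB in e1.
have e2 := @gpE _ y z x erefl; rewrite -/z.
have zx : flen z = flen x by lia.
have mz : minimal_pair z y.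
  by split=> // x' y' /mxy.2; rewrite zx.
have m1 := minimal_gp mz; have m2 := minimal_gp (minimal_inv mz).
have m3 := minimal_gp (minimal_swap (minimal_inv (minimal_swap mz))).
have m4 := minimal_gp (minimal_inv (minimal_swap (minimal_inv (minimal_swap mz)))).
have m0 := minimal_gp (minimal_inv mxy).
have /gpE e3 : (z^-1 * y)%g = x^-1%g by rewrite /z invgM mulgVK.
have hy := gp_inv_lt y1.
have z1 : z != 1%g by rewrite -flen_eq0 zx flen_eq0.
have hz := gp_inv_lt z1.
have u1 := gp_ultra y z y^-1%g.
have u2 := gp_ultra z^-1%g x^-1%g y.
have u3 := gp_ultra y z^-1%g y^-1%g.
have u4 := gp_ultra z y z^-1%g.
rewrite (gpC y z) in e2 u1; rewrite (gpC y z^-1%g) in u3 u4.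
rewrite !flenV in e3 m0 m2 m3 m4.
split=> //; split; split=> //; rewrite ?zx; lia.
Qed.

(** A pair of minimal total length cancels at most halves. It can fail to be half free only if both
    halves of one element cancel, and then one more move that keeps the total length repairs it. *)
Lemma nielsen_reduction x0 y0 : P x0 y0 ->
  exists x y, P x y /\ (x = 1%g \/ half_free x y).
Proof.
move=> P0.
pose Q n := `[< exists x y, P x y /\ (flen x + flen y = n)%N >].
have exQ : exists n, Q n by exists (flen x0 + flen y0)%N; apply/asboolP; exists x0, y0.
case: (ex_minnP exQ) => n /asboolP[x [y [Pxy <-]]] minQ.
have mxy : minimal_pair x y.
  by split=> // x' y' P'; apply: minQ; apply/asboolP; exists x', y'.
have [x1|x1] := eqVneq x 1%g; first by exists x, y; split=> //; left.
have [y1|y1] := eqVneq y 1%g.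
  by exists y, x; split; [exact: Pswap | left].
have myx := minimal_swap mxy; have mXy := minimal_inv mxy.
have mYx := minimal_inv myx.
have xV1 : x^-1%g != 1%g by rewrite invg_eq1.
have yV1 : y^-1%g != 1%g by rewrite invg_eq1.
have m1 := minimal_gp mxy; have m2 := minimal_gp mXy.
have m3 := minimal_gp mYx; have m4 := minimal_gp (minimal_inv (minimal_swap mYx)).
rewrite !(gpC y^-1%g x) !flenV in m2 m3 m4.
have ux := gp_inv_lt x1; have uy := gp_inv_lt y1.
(* An element sharing half of [y] with both [y] and [y^-1] would contradict [gp_inv_lt] by the
   ultrametric inequality; likewise with [x] and [y] exchanged. This leaves the four cases below. *)
have v1 := gp_ultra y x y^-1%g; have v2 := gp_ultra y x^-1%g y^-1%g.
have w1 := gp_ultra x y x^-1%g; have w2 := gp_ultra x y^-1%g x^-1%g.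
rewrite (gpC y x) in v1; rewrite (gpC y x^-1%g) in v2.
rewrite (gpC y x^-1%g) (gpC y^-1%g x^-1%g) in w1 w2.
have [/andP[a1 a2]|nA] := boolP ((gp x^-1%g y == flen y) && (gp x y^-1%g == flen y)).
  have [] := minimal_half_free mxy x1 y1 (eqP a1) (eqP a2).
  by exists (y * x)%g, y; split=> //; right.
have [/andP[a1 a2]|nB] := boolP ((gp x y == flen y) && (gp x^-1%g y^-1%g == flen y)).
  have [|| Pz hz] := @minimal_half_free x^-1%g y mXy xV1 y1.
  - by rewrite invgK (eqP a1).
  - by rewrite (eqP a2).
  by exists (y * x^-1)%g, y; split=> //; right.
have [/andP[a1 a2]|nC] := boolP ((gp x y^-1%g == flen x) && (gp x^-1%g y == flen x)).
  have [|| Pz hz] := @minimal_half_free y x myx y1 x1.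
  - by rewrite gpC (eqP a1).
  - by rewrite gpC (eqP a2).
  by exists (x * y)%g, x; split=> //; right.
have [/andP[a1 a2]|nD] := boolP ((gp x y == flen x) && (gp x^-1%g y^-1%g == flen x)).
  have [|| Pz hz] := @minimal_half_free y^-1%g x mYx yV1 x1.
  - by rewrite invgK gpC (eqP a1).
  - by rewrite gpC (eqP a2).
  by exists (x * y^-1)%g, x; split=> //; right.
exists x, y; split=> //; right; split; first by split=> //; rewrite 1?minnC.
split=> //.
  clear nC nD w1 w2 ux; lia.
clear nA nB v1 v2 uy; lia.
Qed.

End NielsenReduction.

(** * Test elements *)

Section IntegerPower.
Variable G : groupType.
Implicit Types u : G.

Definition expgz u (z : int) : G :=
  match z with Posz n => u ^+ n | Negz n => u^-1 ^+ n.+1 end%g.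

Lemma expgzD1 u z : expgz u (1 + z) = (u * expgz u z)%g.
Proof.
case: z => [n|[|n]].
- by rewrite -expgS.
- by rewrite (_ : 1 + Negz 0 = 0) //= expg1 mulgV.
- rewrite (_ : 1 + Negz n.+1 = Negz n); last by lia.
  by rewrite /= [(u^-1 ^+ n.+2)%g]expgS mulVKg.
Qed.

Lemma expgzB1 u z : expgz u (- 1 + z) = (u^-1 * expgz u z)%g.
Proof.
case: z => [[|n]|n].
- by rewrite (_ : - 1 + Posz 0 = Negz 0) //= expg1 mulg1.
- rewrite (_ : - 1 + Posz n.+1 = Posz n); last by lia.
  by rewrite /= expgS mulKg.
- rewrite (_ : - 1 + Negz n = Negz n.+1); last by lia.
  by rewrite /= -expgS.
Qed.

Lemma expgzD u m n : expgz u (m + n) = (expgz u m * expgz u n)%g.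
Proof.
elim: m => [|m IH|m IH]; first by rewrite add0r mul1g.
- by rewrite intS -addrA !expgzD1 IH mulgA.
- by rewrite intS opprD -addrA !expgzB1 IH mulgA.
Qed.

Lemma expgz_abs u z : exists v, expgz u z = (v ^+ `|z|%N)%g.
Proof. by case: z => n; [exists u | exists u^-1%g]. Qed.

End IntegerPower.

Section Exponent.
Variable X : choiceType.
Local Notation F := (freegroup X).
Implicit Types (i : X) (s : seq (X * bool)) (w : F).

Definition letter_exp i (l : X * bool) : int :=
  if l.1 == i then (if l.2 then 1 else - 1) else 0.

Definition exponent i s : int := \sum_(l <- s) letter_exp i l.

Lemma exponent_cons i l s : exponent i (l :: s) = letter_exp i l + exponent i s.
Proof. exact: big_cons. Qed.

Lemma letter_exp_linv i l : letter_exp i (linv l) = - letter_exp i l.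
Proof.
by case: l => j []; rewrite /letter_exp /=; case: eqP => _; rewrite ?oppr0 ?opprK.
Qed.

Lemma exponent_lmul i l s : exponent i (lmul l s) = letter_exp i l + exponent i s.
Proof.
case: s => [|m s] /=; first exact: exponent_cons.
case: eqP => [->|_]; last exact: exponent_cons.
by rewrite exponent_cons letter_exp_linv addNKr.
Qed.

Lemma exponentM i (u v : F) :
  exponent i (fword (u * v)%g) = exponent i (fword u) + exponent i (fword v).
Proof.
rewrite /=; elim: (fword u) => [|l s IH] /=; first by rewrite /exponent big_nil add0r.
by rewrite exponent_lmul IH exponent_cons addrA.
Qed.

End Exponent.

Section Evaluation.
Variables (X : choiceType) (H : groupType).
Local Notation F := (freegroup X).
Implicit Types (h : X -> H) (s : seq (X * bool)).

(** Bare functions with a morphism identity replace bundled morphisms from here on, so that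
    compositions and iterates need no packing. *)
Lemma morph_weval (k : F -> H) : {morph k : u v / (u * v)%g} ->
  forall w, k w = weval (fun i => k (fgen i)) (fword w).
Proof.
move=> kM; pose h i := k (fgen i).
have [f [_ uniq]] := freegroup_universal h.
have ext (g : F -> H) : {morph g : u v / (u * v)%g} ->
    (forall i, g (fgen i) = h i) -> g =1 f.
  move=> gM gh; pose gm := isMultiplicative.Build F H g gM.
  pose g' : {multiplicative F -> H} := HB.pack g gm.
  exact: (uniq g').
move=> w; rewrite ext//.
rewrite (ext (fun w => weval h (fword w)))// => [u v|i]; first exact: weval_wmul.
by rewrite /= /leval /= mulg1.
Qed.

Lemma weval_morph h : {morph (fun w : F => weval h (fword w)) : u v / (u * v)%g}.
Proof. by move=> u v; exact: weval_wmul. Qed.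

Lemma weval_fgen h i : weval h (fword (fgen i)) = h i.
Proof. by rewrite /= /leval /= mulg1. Qed.

Lemma morph_ext (k k' : F -> H) :
  {morph k : u v / (u * v)%g} -> {morph k' : u v / (u * v)%g} ->
  (forall i, k (fgen i) = k' (fgen i)) -> k =1 k'.
Proof.
move=> kM kM' e w; rewrite (morph_weval kM) (morph_weval kM').
by congr (weval _ _); apply: funext.
Qed.

Lemma weval_single h i s : (forall l, l \in s -> l.1 = i \/ h l.1 = 1%g) ->
  weval h s = expgz (h i) (exponent i s).
Proof.
elim: s => [|l s IH] hs; first by rewrite /exponent big_nil.
rewrite exponent_cons /= IH => [|m ms]; last by apply: hs; rewrite inE ms orbT.
have /hs : l \in l :: s by rewrite inE eqxx.
rewrite /leval /letter_exp; have [->|li] := eqVneq l.1 i.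
  by move=> _; case: l.2; rewrite ?expgzD1 ?expgzB1.
case=> [/eqP|->]; first by rewrite (negbTE li).
by rewrite invg1 if_same mul1g add0r.
Qed.

End Evaluation.

(** * Visible elements and automorphisms of the free group of rank two *)

Section TestElements.
Local Notation X := (fintype_ordinal__canonical__choice_Choice 2).
Local Notation F := (freegroup X).
Local Notation morph k := {morph k : u v / (u * v)%g}.

Definition ia : X := ord0.
Definition ib : X := ord_max.

Lemma ord2_cover (i : X) : i = ia \/ i = ib.
Proof.
by case: i => [[|[|//]] hi]; [left | right]; exact: val_inj.
Qed.

Definition hpair (G : Type) (x y : G) (i : X) : G := if i == ia then x else y.

Definition visible (w : F) : bool :=
  coprime `|exponent ia (fword w)|%N `|exponent ib (fword w)|%N.

Definition proper_power (w : F) : Prop := exists u k, (2 <= k)%N /\ w = (u ^+ k)%g.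

Lemma morphV (k : F -> F) (u : F) : morph k -> k u^-1%g = (k u)^-1%g.
Proof.
move=> kM; have k1 : k 1%g = 1%g by apply: (@mulgI _ (k 1%g)); rewrite -kM !mulg1.
by apply: (@mulgI _ (k u)); rewrite -kM !mulgV k1.
Qed.

(** An additive map to the integers factors through the abelianization, hence is a linear form in
    the two exponent sums. *)
Lemma additive_exponent (m : F -> int) : {morph m : u v / (u * v)%g >-> u + v} ->
  forall w, m w = m (fgen ia) * exponent ia (fword w) + m (fgen ib) * exponent ib (fword w).
Proof.
move=> mM [s rs].
have m1 : m 1%g = 0 by apply: (@addrI _ (m 1%g)); rewrite -mM mulg1 addr0.
have mV u : m u^-1%g = - m u.
  by apply: (@addrI _ (m u)); rewrite -mM mulgV m1 subrr.
rewrite /=; elim: s rs => [|l s IH] rs.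
  rewrite /exponent !big_nil !mulr0 addr0 -[RHS]m1; congr m; exact: val_inj.
have rs' : reduced s := path_sorted rs.
pose lw : F := @FreeWord _ [:: l] isT.
have e : FreeWord rs = (lw * FreeWord rs')%g.
  by apply: val_inj => /=; rewrite lmul_cons.
rewrite e mM (IH rs') !exponent_cons.
suff -> : m lw = m (fgen ia) * letter_exp ia l + m (fgen ib) * letter_exp ib l by ring.
case: l @lw {rs e} => i [] lw; rewrite /letter_exp /=.
  have -> : lw = fgen i by exact: val_inj.
  by case: (ord2_cover i) => -> /=; ring.
have -> : lw = (fgen i)^-1%g by exact: val_inj.
by rewrite mV; case: (ord2_cover i) => -> /=; ring.
Qed.

Lemma visible_not_test (w : F) : visible w -> ~ test_element w.
Proof.
move=> cw tw.
pose x := exponent ia (fword w); pose y := exponent ib (fword w).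
have [p [q pq]] : exists p q : int, p * x + q * y = 1.
  have [p [q e]] := Bezoutz x y; exists p, q.
  by rewrite e /gcdz; move: cw; rewrite /visible /coprime => /eqP ->.
pose k (u : F) := expgz w (p * exponent ia (fword u) + q * exponent ib (fword u)).
have kM : morph k by move=> u v; rewrite /k !exponentM -expgzD; congr expgz; ring.
pose km := isMultiplicative.Build F F k kM.
pose k' : {multiplicative F -> F} := HB.pack k km.
have kw : k w = w by rewrite /k -/x -/y pq /= expg1.
have [k2 kK _] := tw k' kw.
(* The image of [k] lies in the powers of [w], so [k] identifies ab with ba and is not injective. *)
have : k (fgen ia * fgen ib)%g = k (fgen ib * fgen ia)%g.
  by rewrite !kM /k -!expgzD addrC.
by move=> /(can_inj kK)/(congr1 (@fword _)).
Qed.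

Definition mutual_inverse (phi psi : F -> F) :=
  [/\ morph phi, morph psi, cancel phi psi & cancel psi phi].

Lemma mutual_inverse_comp phi psi phi' psi' : mutual_inverse phi psi ->
  mutual_inverse phi' psi' -> mutual_inverse (phi \o phi') (psi' \o psi).
Proof.
case=> h1 h2 h3 h4 [h1' h2' h3' h4']; split => [u v|u v|u|u] /=.
- by rewrite h1' h1.
- by rewrite h2 h2'.
- by rewrite h3.
- by rewrite h4'.
Qed.

Definition endo (x y : F) (w : F) : F := weval (hpair x y) (fword w).

Lemma endo_morph x y : morph (endo x y).
Proof. exact: weval_morph. Qed.

Lemma endo_ia x y : endo x y (fgen ia) = x.
Proof. exact: weval_fgen. Qed.

Lemma endo_ib x y : endo x y (fgen ib) = y.
Proof. exact: weval_fgen. Qed.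

Lemma endo_mutual x y x' y' :
  endo x' y' x = fgen ia -> endo x' y' y = fgen ib ->
  endo x y x' = fgen ia -> endo x y y' = fgen ib ->
  mutual_inverse (endo x y) (endo x' y').
Proof.
move=> h1 h2 h3 h4; split; try exact: endo_morph.
  apply: (@morph_ext _ _ (endo x' y' \o endo x y) id) => // [u v|i] /=.
    by rewrite !endo_morph.
  by case: (ord2_cover i) => ->; rewrite ?endo_ia ?endo_ib.
apply: (@morph_ext _ _ (endo x y \o endo x' y') id) => // [u v|i] /=.
  by rewrite !endo_morph.
by case: (ord2_cover i) => ->; rewrite ?endo_ia ?endo_ib.
Qed.

Lemma swap_mutual :
  mutual_inverse (endo (fgen ib) (fgen ia)) (endo (fgen ib) (fgen ia)).
Proof. by apply: endo_mutual; rewrite ?endo_ia ?endo_ib. Qed.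

Lemma inv_mutual :
  mutual_inverse (endo (fgen ia)^-1%g (fgen ib)) (endo (fgen ia)^-1%g (fgen ib)).
Proof.
by apply: endo_mutual; rewrite ?(morphV _ (endo_morph _ _)) ?endo_ia ?endo_ib ?invgK.
Qed.

Lemma mul_mutual :
  mutual_inverse (endo (fgen ia * fgen ib)%g (fgen ib))
                 (endo (fgen ia * (fgen ib)^-1)%g (fgen ib)).
Proof.
by apply: endo_mutual; rewrite ?endo_morph ?(morphV _ (endo_morph _ _)) ?endo_ia ?endo_ib
  ?mulgVK ?mulgK.
Qed.

(** The reduction is applied to the images under [f] of all free bases; each elementary move amounts
    to precomposing [phi] with an elementary automorphism. *)
Lemma nielsen_automorphism (f : F -> F) : morph f -> exists phi psi,
  mutual_inverse phi psi /\
  let h i := f (phi (fgen i)) in h ia = 1%g \/ nielsen_reduced h.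
Proof.
move=> fM.
pose P (x y : F) := exists phi psi, [/\ mutual_inverse phi psi,
  x = f (phi (fgen ia)) & y = f (phi (fgen ib))].
have [||||x [y [[phi [psi [m -> ->]]] h]]] :=
    @nielsen_reduction _ P _ _ _ (f (fgen ia)) (f (fgen ib)).
- move=> x y [phi [psi [m -> ->]]].
  do 2 eexists; split; first exact: mutual_inverse_comp m swap_mutual.
    by rewrite /= endo_ia.
  by rewrite /= endo_ib.
- move=> x y [phi [psi [m -> ->]]].
  do 2 eexists; split; first exact: mutual_inverse_comp m inv_mutual.
    by case: m => pM _ _ _; rewrite /= endo_ia !morphV.
  by rewrite /= endo_ib.
- move=> x y [phi [psi [m -> ->]]].
  do 2 eexists; split; first exact: mutual_inverse_comp m mul_mutual.
    by case: m => pM _ _ _; rewrite /= endo_ia pM fM.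
  by rewrite /= endo_ib.
- by exists id, id.
- exists phi, psi; split => //=.
  case: h => [->|h]; [by left | right].
  by apply: (half_free_reduced (a := ia) (b := ib)) => //; exact: ord2_cover.
Qed.

End TestElements.

(** * Non-test elements are visible or proper powers *)

Section NonTest.
Local Notation X := (fintype_ordinal__canonical__choice_Choice 2).
Local Notation F := (freegroup X).
Local Notation morph k := {morph k : u v / (u * v)%g}.

(** Here [w] is the power with exponent [e] of one generator's image. If |e| is at least 2 it is a
    proper power, and if e = 0 it is 1 = 1^2. If |e| = 1, then [e] is an integral combination of the
    exponents of [w], which are therefore coprime. *)
Lemma one_letter_visible_or_power (k psi : F -> F) (w : F) (i : X) :
  morph k -> morph psi -> k (psi w) = w ->
  (forall l, l \in fword (psi w) -> l.1 = i \/ k (fgen l.1) = 1%g) ->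
  visible w \/ proper_power w.
Proof.
move=> kM pM kw h.
have := @weval_single X _ (fun j => k (fgen j)) i _ h.
rewrite -(morph_weval kM) kw; set e := exponent i _ => we.
have [v ev] := expgz_abs (k (fgen i)) e.
have [e2|e2] := leqP 2 `|e|%N; first by right; exists v, `|e|%N; rewrite we ev.
have [e0|e0] := eqVneq `|e|%N 0%N.
  by right; exists 1%g, 2%N; rewrite expg1n we ev e0.
left; rewrite /visible /coprime; set d := gcdn _ _.
have mM : {morph (fun u : F => exponent i (fword (psi u))) :
    u v / (u * v)%g >-> u + v} by move=> x y; rewrite pM exponentM.
have := additive_exponent mM w; rewrite -/e => ee.
have : (Posz d %| e)%Z.
  by rewrite ee rpredD//; apply: dvdz_mull; rewrite dvdzE /= ?dvdn_gcdl ?dvdn_gcdr.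
by rewrite dvdzE /= (_ : `|e|%N = 1%N) ?dvdn1//; lia.
Qed.

Lemma fixed_point_nielsen_reduced (f : F -> F) (w : F) : morph f -> f w = w ->
  ~ (visible w \/ proper_power w) ->
  exists phi psi, [/\ mutual_inverse phi psi,
    nielsen_reduced (fun i => f (phi (fgen i))) &
    forall i, (flen (f (phi (fgen i))) <= flen w)%N].
Proof.
move=> fM fw nw; have [phi [psi [m hN]]] := nielsen_automorphism fM.
exists phi, psi; case: (m) => pM sM pK sK.
have kM : morph (f \o phi) by move=> u v /=; rewrite pM fM.
have kw : (f \o phi) (psi w) = w by rewrite /= sK.
(* If generator [i] did not occur with nontrivial image, [w] would be a product of copies of the
   other one, which is excluded. *)
have used i : exists2 l, l \in fword (psi w) & l.1 = i /\ f (phi (fgen l.1)) <> 1%g.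
  apply: contrapT => h; apply: nw.
  pose j := if i == ia then ib else ia.
  apply: (one_letter_visible_or_power (i := j) kM sM kw) => l ls.
  have [lj|lj] := eqVneq l.1 j; [by left | right].
  apply: contrapT => l1; apply: h; exists l => //; split=> //.
  rewrite /j in lj; case: (ord2_cover l.1) (ord2_cover i) lj => -> [] -> //.
case: hN => /= [h1|N]; first by have [l _ [->]] := used ia.
split=> // i; have [l ls [<- _]] := used i.
have := flen_letter_le N (fwordP (psi w)) ls.
rewrite -(morph_weval kM) kw; congr (_ <= _)%N.
by rewrite /leval; case: l.2 => //; rewrite flenV.
Qed.

Lemma iter_morph (f : F -> F) n : morph f -> morph (iter n f).
Proof. by move=> fM; elim: n => [//|n IH] u v; rewrite !iterS IH fM. Qed.

Lemma finite_flen (n : nat) : finite_set [set u : F | (flen u <= n)%N].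
Proof.
apply: sub_finite_set (@finite_ball 'I_2 n setT) => u /= h; by split.
Qed.

(* The reduced generators of the images of the iterates of [f] have length at
   most [flen w], so two iterates have the same image, which makes [f] onto. *)
Lemma non_test_visible_or_power (w : F) : ~ test_element w ->
  visible w \/ proper_power w.
Proof.
move=> ntw; apply: contrapT => nw; apply: ntw => f fw.
have fM : morph f by exact: gmulfM.
have iw n : iter n f w = w by elim: n => //= n ->.
have /choice[p hp] : forall n, exists p : F * F, exists phi psi,
    [/\ mutual_inverse phi psi,
      nielsen_reduced (fun i => iter n f (phi (fgen i))),
      p = (iter n f (phi (fgen ia)), iter n f (phi (fgen ib))),
      (flen p.1 <= flen w)%N & (flen p.2 <= flen w)%N].
  move=> n; have [phi [psi [m N le]]] := fixed_point_nielsen_reduced (iter_morph n fM) (iw n) nw.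
  by exists (iter n f (phi (fgen ia)), iter n f (phi (fgen ib))), phi, psi; split => //=.
(* For n = 1 the reduced generators are those of f(F) itself, and an evaluation at a reduced pair
   kills no nontrivial word. *)
have finj : injective f.
  have [phi [psi [[pM sM pK sK] N _ _ _]]] := hp 1%N.
  have ker u : f u = 1%g -> u = 1%g.
    move=> fu; apply/eqP; apply: contraT => u1.
    have v1 : psi u != 1%g.
      apply: contra u1 => /eqP v1; rewrite -(sK u) v1.
      by apply/eqP/(@mulgI _ (phi 1%g)); rewrite -pM !mulg1.
    have := nielsen_reduced_neq1 N v1.
    have kM : morph (iter 1 f \o phi) by move=> x y /=; rewrite pM fM.
    by rewrite -(morph_weval kM) /= sK fu eqxx.
  move=> u v uv; apply/eqP; rewrite -divg_eq1; apply/eqP/ker.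
  by rewrite fM (morphV _ fM) uv mulgV.
have [n [m [nm pnm]]] : exists n m, (n < m)%N /\ p n = p m.
  apply: contrapT => h.
  have pinj : injective p.
    move=> n m pnm; apply: contrapT => /eqP; rewrite neq_ltn => /orP[nm|nm]; apply: h.
      by exists n, m.
    by exists m, n.
  apply: infinite_nat.
  have fin := finite_setX (finite_flen (flen w)) (finite_flen (flen w)).
  apply: sub_finite_set (finite_preimage _ fin) => [n _|x y _ _]; last exact: pinj.
  by have [phi [psi [_ _ _ ? ?]]] := hp n; split.
(* Equal generators give f^n(phi u) = f^m(phi' u) with n < m; cancelling the injective f^n at u =
   psi y exhibits [y] in the image of [f]. *)
have fsurj y : exists x, f x = y.
  have [phi [psi [[pM sM pK sK] _ e _ _]]] := hp n.
  have [phi' [psi' [[pM' sM' pK' sK'] _ e' _ _]]] := hp m.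
  have ee : iter n f \o phi =1 iter m f \o phi'.
    apply: morph_ext => [u v|u v|i] /=.
    - by rewrite pM iter_morph.
    - by rewrite pM' iter_morph.
    - by move: pnm; rewrite e e' => -[? ?]; case: (ord2_cover i) => ->.
  have := ee (psi y); rewrite /= sK.
  have -> : iter m f = iter n f \o f \o iter (m - n.+1) f.
    by apply: funext => u /=; rewrite -iterSr -iterD; congr (iter _ f u); lia.
  have ninj : injective (iter n f).
    by elim: n {nm pnm e ee} => //= k IH u v /finj/IH.
  by move=> /ninj yE; exists (iter (m - n.+1) f (phi' (psi y))).
have [g gK] := choice fsurj.
by exists g => // u; apply: finj; rewrite gK.
Qed.

End NonTest.

(** * The abelianization of a random reduced word *)

Section ReducedWords.
Local Notation X := (fintype_ordinal__canonical__choice_Choice 2).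
Local Notation L := (X * bool)%type.

Definition letters : seq L := [:: (ia, true); (ia, false); (ib, true); (ib, false)].

Lemma mem_letters l : l \in letters.
Proof. by case: l => i []; case: (ord2_cover i) => ->; rewrite !inE eqxx ?orbT. Qed.

Fixpoint rwords n : seq (seq L) :=
  if n is n'.+1 then
    [seq l :: s | l <- letters, s <- [seq s <- rwords n' | reduced (l :: s)]]
  else [:: [::]].

Lemma rwordsS n : rwords n.+1 =
  [seq l :: s | l <- letters, s <- [seq s <- rwords n | reduced (l :: s)]].
Proof. by []. Qed.

Arguments rwords : simpl never.

Lemma mem_rwords n s : (s \in rwords n) = reduced s && (size s == n).
Proof.
elim: n s => [|n IH] s; first by case: s => [|l s]; rewrite /rwords //= andbF.
apply/allpairsPdep/andP => [[l [t [_ + ->]]]|].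
  by rewrite mem_filter IH => /and3P[-> _ /eqP <-].
case: s => [[]//|l s] [rs /= /eqP[sn]]; exists l, s; split=> //.
  exact: mem_letters.
rewrite mem_filter IH sn eqxx andbT; apply/andP; split=> //.
exact: path_sorted rs.
Qed.

Lemma rwords_uniq n : uniq (rwords n).
Proof.
elim: n => [//|n IH]; apply: allpairs_uniq_dep => //.
  by move=> l _; exact: filter_uniq.
by move=> [l s] [m t] _ _ /= [-> ->].
Qed.

Lemma size_rwords n : size (rwords n.+1) = (4 * 3 ^ n)%N.
Proof.
elim: n => [//|n IH].
rewrite -sum1_size rwordsS big_allpairs_dep.
under eq_bigr do rewrite big_filter.
rewrite (exchange_big_dep predT)//= big_seq.
rewrite (eq_bigr (fun _ => 3%N)) => [|s]; last first.
  rewrite mem_rwords => /andP[]; case: s => // m s rs _.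
  rewrite big_mkcond /= /letters !big_cons big_nil /reduced /=.
  rewrite [path _ _ _]rs !andbT.
  by case: m {rs} => i []; case: (ord2_cover i) => -> /=.
by rewrite -big_seq big_const_seq count_predT iter_addn_0 IH expnS mulnCA.
Qed.

Variable R : realType.
Implicit Types h : int -> int -> R.

Definition wsum n h : R :=
  \sum_(s <- rwords n) h (exponent ia s) (exponent ib s).

(** The adjacency operator of the square lattice Z^2. *)
Definition neighbours h (x y : int) : R :=
  h (x + 1) y + h (x - 1) y + h x (y + 1) + h x (y - 1).

Lemma wsumS n h : wsum n.+1 h = \sum_(l <- letters) \sum_(s <- rwords n | reduced (l :: s))
  h (exponent ia (l :: s)) (exponent ib (l :: s)).
Proof.
rewrite /wsum rwordsS big_allpairs_dep; apply: eq_bigr => l _.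
by rewrite big_filter.
Qed.

Lemma sum_neighbours h s : neighbours h (exponent ia s) (exponent ib s) =
  \sum_(l <- letters) h (exponent ia (l :: s)) (exponent ib (l :: s)).
Proof.
rewrite /letters !big_cons big_nil !exponent_cons /letter_exp /= !add0r addr0.
rewrite /neighbours ![_ + exponent _ _]addrC -!addrA; congr (_ + (_ + _)).
Qed.

(** A nonempty reduced word can be extended on the left by every letter but the inverse of its first
    one. *)
Lemma sum_reduced_cons n (f : seq L -> R) :
  \sum_(l <- letters) \sum_(s <- rwords n.+1 | reduced (l :: s)) f s =
  3 * \sum_(s <- rwords n.+1) f s.
Proof.
rewrite (exchange_big_dep predT)//= mulr_sumr big_seq [RHS]big_seq.
apply: eq_bigr => s; rewrite mem_rwords => /andP[]; case: s => // m s rs _.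
rewrite big_mkcond /= /letters !big_cons big_nil /reduced /=.
rewrite -/(reduced (m :: s)) [path _ _ _]rs !andbT.
by case: m {rs} => i []; case: (ord2_cover i) => -> /=; ring.
Qed.

(* Prepend a letter to every word and subtract the words where it cancels. *)
Lemma wsum_rec_aux n h :
  wsum n.+2 h = wsum n.+1 (neighbours h) -
  \sum_(l <- letters) \sum_(s <- rwords n | reduced (l :: s))
    h (exponent ia s) (exponent ib s).
Proof.
pose H s := h (exponent ia s) (exponent ib s).
have -> : wsum n.+1 (neighbours h) =
    \sum_(l <- letters) \sum_(s <- rwords n.+1) H (l :: s).
  by rewrite exchange_big /=; apply: eq_bigr => s _; rewrite sum_neighbours.
rewrite wsumS -/H.
(* Exchanging each letter with its inverse turns the correction into the sum over the words l^-1 s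
   on which prepending [l] cancels. *)
have -> : \sum_(l <- letters) \sum_(s <- rwords n | reduced (l :: s)) H s =
    \sum_(l <- letters) \sum_(s <- rwords n | reduced (linv l :: s)) H s.
  by rewrite /letters !big_cons !big_nil /linv /=; ring.
apply/eqP; rewrite eq_sym subr_eq -big_split /=; apply/eqP/eq_bigr => l _.
rewrite (bigID (fun s => reduced (l :: s))) /=; congr (_ + _).
rewrite rwordsS big_mkcond big_allpairs_dep.
rewrite (bigD1_seq (linv l)) ?mem_letters//= [X in _ + X]big1 => [|m ml]; last first.
  rewrite big_filter big1 // => s rs.
  by rewrite /reduced /= in rs *; rewrite ml rs.
rewrite addr0 big_filter; apply: eq_bigr => s rs.
rewrite eqxx /= /H !exponent_cons !letter_exp_linv !addrA !subrr !add0r.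
by [].
Qed.

Lemma wsum_rec n h :
  wsum n.+3 h = wsum n.+2 (neighbours h) - 3 * wsum n.+1 h.
Proof. by rewrite wsum_rec_aux sum_reduced_cons. Qed.

Lemma wsum0 h : wsum 0 h = h 0 0.
Proof.
rewrite /wsum (_ : rwords 0 = [:: [::]])// big_cons big_nil /exponent !big_nil.
by rewrite addr0.
Qed.

(** The empty word can be extended by all four letters, hence the coefficient 4 in place of 3. *)
Lemma wsum2 h : wsum 2 h = wsum 1 (neighbours h) - 4 * wsum 0 h.
Proof.
rewrite wsum_rec_aux wsum0 (_ : rwords 0 = [:: [::]])// /letters.
rewrite !big_cons !big_nil /exponent !big_nil /=; congr (_ - _); ring.
Qed.

Lemma wsum1 h : wsum 1 h = neighbours h 0 0.
Proof.
rewrite wsumS (_ : rwords 0 = [:: [::]])// /letters !big_cons !big_nil /=.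
rewrite /exponent !big_cons !big_nil /letter_exp /=.
by rewrite /neighbours !addr0 !add0r !addrA.
Qed.

End ReducedWords.

(** * Growth of the solutions of the recurrence *)

Section Recurrence.
Variable R : realFieldType.
Implicit Types (t : R) (n : nat).

(* Rescaled Chebyshev polynomials of the second kind. *)
Fixpoint chebU t n : R :=
  match n with
  | 0 => 1
  | 1 => t
  | (n''.+1 as n').+1 => t * chebU t n' - 3 * chebU t n''
  end.

Lemma chebUSS t n : chebU t n.+2 = t * chebU t n.+1 - 3 * chebU t n.
Proof. by []. Qed.

Lemma chebU_norm_opp t n : `|chebU (- t) n| = `|chebU t n|.
Proof.
suff [-> _] : chebU (- t) n = (-1) ^+ n * chebU t n /\
    chebU (- t) n.+1 = (-1) ^+ n.+1 * chebU t n.+1 by rewrite normrM normrX normrN1 expr1n mul1r.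
elim: n => [|n [IH1 IH2]]; first by split; rewrite /= ?expr1; ring.
by split=> //; rewrite !chebUSS IH1 IH2 !exprS; ring.
Qed.

(** With steps of two, the coefficient t^2 - 6 is at most 25/4 in absolute value for |t| up to 7/2.
    The triangle inequality for single steps would give a growth factor above 3. *)
Lemma chebU4 t n : chebU t n.+4 = (t ^+ 2 - 6) * chebU t n.+2 - 9 * chebU t n.
Proof. by rewrite !chebUSS; ring. Qed.

(** The base r = 69/25 is 3 times 23/25, the least value of [rate], and satisfies 25/4 r^2 + 9 <=
    r^4, which closes the induction. *)
Lemma chebU_small t n : `|t| <= 7 / 2 -> `|chebU t n| <= 64 * (69 / 25) ^+ n.
Proof.
move=> ht; have [r rE] : exists r : R, r = 69 / 25 by eexists.
rewrite -rE.
have ht4 : `|t| <= 4 by lra.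
have [t1 t2] : - (7 / 2) <= t /\ t <= 7 / 2 by move: ht; rewrite ler_norml => /andP.
have tp : 0 <= (7 / 2 - t) * (7 / 2 + t) by apply: mulr_ge0; lra.
have t20 : 0 <= t ^+ 2 by rewrite sqr_ge0.
have tt : `|t ^+ 2 - 6| <= 25 / 4 by rewrite ler_norml; apply/andP; split; lra.
have r1 : 1 <= r by rewrite rE; lra.
have rn k : 1 <= r ^+ k by rewrite exprn_ege1.
suff : [/\ `|chebU t n| <= 64 * r ^+ n, `|chebU t n.+1| <= 64 * r ^+ n.+1,
          `|chebU t n.+2| <= 64 * r ^+ n.+2 & `|chebU t n.+3| <= 64 * r ^+ n.+3] by case.
elim: n => [|n [h0 h1 h2 h3]].
  have a2 : `|t ^+ 2 - 3| <= 64 by rewrite ler_norml; apply/andP; split; lra.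
  have a3 : `|t ^+ 3 - 6 * t| <= 64.
    rewrite (_ : _ - _ = (t ^+ 2 - 6) * t); last by ring.
    by rewrite normrM; apply: le_trans (ler_pM _ _ tt ht4) _ => //; lra.
  have e2 : chebU t 2 = t ^+ 2 - 3 by rewrite /=; ring.
  have e3 : chebU t 3 = t ^+ 3 - 6 * t by rewrite /=; ring.
  split; rewrite ?e2 ?e3.
  - by rewrite normr1 expr0; lra.
  - by have := rn 1%N; rewrite /=; lra.
  - by have := rn 2%N; lra.
  - by have := rn 3%N; lra.
split=> //; rewrite chebU4.
apply: le_trans (ler_normB _ _) _; rewrite !normrM (ger0_norm (_ : 0 <= 9))//.
have -> : r ^+ n.+4 = r ^+ 4 * r ^+ n by rewrite -exprD.
have e2 : r ^+ n.+2 = r ^+ 2 * r ^+ n by rewrite -exprD.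
rewrite e2 in h2.
have h : `|t ^+ 2 - 6| * `|chebU t n.+2| <= 25 / 4 * (64 * (r ^+ 2 * r ^+ n)).
  by apply: ler_pM.
have rr : 25 / 4 * r ^+ 2 + 9 <= r ^+ 4 by rewrite rE; lra.
have := ler_wpM2r (le_trans ler01 (rn n)) rr; rewrite mulrDl -!mulrA.
move: h h0; generalize (r ^+ 2 * r ^+ n) (r ^+ 4 * r ^+ n) (r ^+ n) => *; lra.
Qed.

(** For t up to 4, t - 1 bounds the larger root of x^2 - t x + 3, with equality at t = 4. The
    induction also needs that the terms grow at least by the factor 3/2. *)
Lemma chebU_large t n : 7 / 2 <= t <= 4 -> 0 <= chebU t n <= 2 * (t - 1) ^+ n.
Proof.
move=> /andP[t1 t2].
have hn k : [/\ 0 <= chebU t k, 3 / 2 * chebU t k <= chebU t k.+1 &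
    chebU t k.+1 <= (t - 1) * chebU t k + 1].
  elim: k => [|k [h1 h2 h3]]; first by rewrite /=; split; lra.
  rewrite chebUSS; split; [lra | nra | nra].
have [-> _ _] /= := hn n.
suff : chebU t n <= 2 * (t - 1) ^+ n - 1 by lra.
elim: n => [|n IH]; first by rewrite expr0 /=; lra.
apply: le_trans (_ : _ <= (t - 1) * chebU t n + 1) _; first by have [] := hn n.
have : (t - 1) * chebU t n <= (t - 1) * (2 * (t - 1) ^+ n - 1) by rewrite ler_wpM2l//; lra.
rewrite exprS mulrBr mulr1 mulrCA; lra.
Qed.

End Recurrence.

Section RateBound.
Variable R : realFieldType.
Implicit Types (t : R) (n : nat).

(* The exponential rate [1 - (16 - t^2) / 200] is not optimal; what matters is
   that it is [1] only at [t = 4] and [t = -4], to first order in [16 - t^2]. *)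
Definition rate t : R := 1 - (16 - t ^+ 2) / 200.

Lemma chebU_bound t n : `|t| <= 4 -> `|chebU t n| <= 64 * (3 * rate t) ^+ n.
Proof.
wlog t0 : t / 0 <= t => [hw|] ht.
  have [/hw|t0] := leP 0 t; first exact.
  rewrite -chebU_norm_opp (_ : rate t = rate (- t)); last by rewrite /rate sqrrN.
  by apply: hw; rewrite ?normrN//; lra.
rewrite ger0_norm// in ht.
have [t1|t1] := leP t (7 / 2).
  apply: le_trans (chebU_small _ _) _; first by rewrite ger0_norm.
  by rewrite ler_pM2l// lerXn2r// ?nnegrE /rate; nra.
have tt : 7 / 2 <= t <= 4 by apply/andP; split; lra.
have /andP[h1 h2] := chebU_large n tt.
rewrite ger0_norm//; apply: le_trans h2 _.
apply: (@le_trans _ _ (64 * (t - 1) ^+ n)).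
  by rewrite ler_wpM2r ?exprn_ge0//; lra.
(* Indeed 3 rate t - (t - 1) = (4 - t) (1 - 3 (4 + t) / 200). *)
by rewrite ler_pM2l// lerXn2r// ?nnegrE /rate; nra.
Qed.

(** Bernoulli's inequality trades exponential decay for a form whose sums over equally spaced angles
    can be telescoped. *)
Lemma exprB1_bernoulli (a : R) n : 0 <= a <= 1 -> (1 - a) ^+ n <= (1 + n%:R * a)^-1.
Proof.
move=> /andP[a0 a1]; have p : 0 < 1 + n%:R * a by rewrite ltr_wpDr// mulr_ge0.
rewrite -[leRHS]mul1r ler_pdivlMr//.
elim: n {p} => [|n IH]; first by rewrite expr0 mul0r addr0 mulr1.
apply: le_trans IH; rewrite exprS mulrC mulrA [leRHS]mulrC ler_wpM2r ?exprn_ge0//; first by lra.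
have : 0 <= n%:R :> R by []. rewrite -natr1; nra.
Qed.

(** Splits the rate into one factor for each angle, so that double sums over angles factor. *)
Lemma rate_le t (a b : R) : 8 * (a + b) <= 16 - t ^+ 2 -> 0 <= a -> 0 <= b ->
  rate t <= (1 - a / 25) * (1 - b / 25).
Proof. by rewrite /rate => h a0 b0; have := mulr_ge0 a0 b0; lra. Qed.

Lemma rate_bounds t : `|t| <= 4 -> 23 / 25 <= rate t <= 1.
Proof.
move=> ht; have : `|t| ^+ 2 <= 4 ^+ 2 by rewrite lerXn2r// ?nnegrE.
rewrite real_normK ?num_real// => h; have := sqr_ge0 t; rewrite /rate => h0.
by apply/andP; split; lra.
Qed.

End RateBound.

(** * Character sums and second moments over spheres *)

Section WordSums.
Variable R : realType.
Implicit Types (h : int -> int -> R) (n : nat) (al be : R).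

Lemma wsum_ext n h h' : (forall x y, h x y = h' x y) -> wsum n h = wsum n h'.
Proof. by move=> e; apply: eq_bigr => s _. Qed.

Lemma wsum_le n h h' : (forall x y, h x y <= h' x y) -> wsum n h <= wsum n h'.
Proof. by move=> e; apply: ler_sum => s _. Qed.

Lemma wsumD n h h' : wsum n (fun x y => h x y + h' x y) = wsum n h + wsum n h'.
Proof. exact: big_split. Qed.

Lemma wsumZ n (c : R) h : wsum n (fun x y => c * h x y) = c * wsum n h.
Proof. by rewrite /wsum mulr_sumr. Qed.

Lemma wsum_sum n (I : Type) (r : seq I) (Q : pred I) (h : I -> int -> int -> R) :
  wsum n (fun x y => \sum_(i <- r | Q i) h i x y) = \sum_(i <- r | Q i) wsum n (h i).
Proof. exact: exchange_big. Qed.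

Lemma wsum_size n : wsum n (fun _ _ => 1 : R) = (size (rwords n))%:R.
Proof. by rewrite /wsum big_const_seq count_predT iter_addr_0. Qed.

Lemma wsum_cst n : wsum n.+1 (fun _ _ => 1 : R) = 4 * 3 ^+ n.
Proof. by rewrite wsum_size size_rwords natrM natrX. Qed.

Lemma wsum_cst_gt0 n : 0 < wsum n (fun _ _ => 1 : R).
Proof.
by case: n => [|n]; [rewrite wsum0 | rewrite wsum_cst mulr_gt0// exprn_gt0].
Qed.

(** The average of the characters of Z^2 with angles (al, be) up to signs; it is real and an
    eigenfunction of [neighbours]. *)
Definition character al be (x y : int) : R := cos (al * x%:~R) * cos (be * y%:~R).

Lemma neighbours_character al be : neighbours (character al be) =
  fun x y => (2 * (cos al + cos be)) * character al be x y.
Proof.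
apply/funext => x; apply/funext => y; rewrite /neighbours /character.
rewrite !intrD !mulrNz !mulr1z !mulrDr !mulrN !mulr1 !cosD !cosN !sinN; ring.
Qed.

(** From length 1 on the sums obey the recurrence of [chebU], with initial values t and t^2 - 4 at
    lengths 1 and 2. *)
Lemma wsum_character al be n : let t := 2 * (cos al + cos be) in
  wsum n.+2 (character al be) = chebU t n.+2 - chebU t n.
Proof.
move=> t; have nb := neighbours_character al be.
have c0 : character al be 0 0 = 1 by rewrite /character !mulr0 cos0 mulr1.
have w1 : wsum 1 (character al be) = t by rewrite wsum1 nb c0 mulr1.
have w2 : wsum 2 (character al be) = chebU t 2 - chebU t 0.
  by rewrite wsum2 nb wsumZ w1 wsum0 c0 -/t /=; ring.
suff [] : wsum n.+2 (character al be) = chebU t n.+2 - chebU t n /\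
   wsum n.+3 (character al be) = chebU t n.+3 - chebU t n.+1 by [].
elim: n => [|n [IH1 IH2]].
  by split=> //; rewrite wsum_rec nb wsumZ w2 w1 -/t !chebUSS /=; ring.
by split=> //; rewrite wsum_rec nb wsumZ IH1 IH2 -/t !chebUSS; ring.
Qed.

Lemma cos_sum_le4 al be : `|2 * (cos al + cos be)| <= 4.
Proof.
rewrite normrM ger0_norm//; have := ler_normD (cos al) (cos be).
by have := cos_max al; have := cos_max be; lra.
Qed.

Lemma wsum_character_bound al be n :
  `|wsum n.+2 (character al be)| <= 80 * (3 * rate (2 * (cos al + cos be))) ^+ n.+2.
Proof.
rewrite wsum_character; set t := 2 * _; have t4 : `|t| <= 4 by exact: cos_sum_le4.
apply: le_trans (ler_normB _ _) _.
have := chebU_bound n.+2 t4; have := chebU_bound n t4.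
have /andP[r1 r2] := rate_bounds t4; set q := 3 * rate t => h1 h2.
(* This absorbs the second term: 80 = 64 + 64 / 4. *)
have q2 : 4 <= q ^+ 2.
  by rewrite -[leLHS](_ : 2 ^+ 2 = 4) ?lerXn2r ?nnegrE//; rewrite /q; lra.
have : 4 * q ^+ n <= q ^+ n.+2.
  by rewrite -(addn2 n) exprD [leRHS]mulrC ler_wpM2r// exprn_ge0// /q; lra.
lra.
Qed.

Lemma wsum_character_decay al be n : `|wsum n.+2 (character al be)| <=
  80 * 3 ^+ n.+2 * ((1 + n.+2%:R * (sin al ^+ 2 / 25))^-1 *
                    (1 + n.+2%:R * (sin be ^+ 2 / 25))^-1).
Proof.
apply: le_trans (wsum_character_bound _ _ _) _; set t := 2 * _.
rewrite exprMn -[leRHS]mulrA ler_pM2l// ler_pM2l ?exprn_gt0//.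
have sa := sqr_ge0 (sin al); have sb := sqr_ge0 (sin be).
have sa1 : sin al ^+ 2 <= 1 by rewrite sin2cos2 gerBl sqr_ge0.
have sb1 : sin be ^+ 2 <= 1 by rewrite sin2cos2 gerBl sqr_ge0.
have /andP[r1 _] : 23 / 25 <= rate t <= 1 by exact: rate_bounds (cos_sum_le4 al be).
have r0 : 0 <= rate t by lra.
have [a0 a1] : 0 <= sin al ^+ 2 / 25 /\ 0 <= 1 - sin al ^+ 2 / 25 by split; lra.
have [b0 b1] : 0 <= sin be ^+ 2 / 25 /\ 0 <= 1 - sin be ^+ 2 / 25 by split; lra.
have rr : rate t <= (1 - sin al ^+ 2 / 25) * (1 - sin be ^+ 2 / 25).
  apply: rate_le => //; rewrite /t !sin2cos2.
  have := sqr_ge0 (cos al - cos be); lra.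
apply: (@le_trans _ _ (((1 - sin al ^+ 2 / 25) * (1 - sin be ^+ 2 / 25)) ^+ n.+2)).
  apply: lerXn2r rr; [exact: r0 | exact: mulr_ge0].
rewrite exprMn; apply: ler_pM; rewrite ?exprn_ge0//.
- by apply: exprB1_bernoulli; rewrite a0; lra.
- by apply: exprB1_bernoulli; rewrite b0; lra.
Qed.

(** The mean square displacement grows at most linearly. As [neighbours q] is 4 q + 4, the
    recurrence propagates a bound on one step, which is carried along in the induction. *)
Lemma wsum_sqr n : wsum n.+1 (fun x y => x%:~R ^+ 2 + y%:~R ^+ 2 : R) <=
  2 * n.+1%:R * wsum n.+1 (fun _ _ => 1).
Proof.
pose q (x y : int) : R := x%:~R ^+ 2 + y%:~R ^+ 2; rewrite -/q.
have nb : neighbours q = fun x y => 4 * q x y + 4 * 1.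
  apply/funext => x; apply/funext => y; rewrite /neighbours /q.
  by rewrite !intrD !mulrNz !mulr1z; ring.
have c1 := wsum_cst.
have w1 : wsum 1 q = 4.
  by rewrite wsum1 nb /q !expr2 !mulr0; ring.
have w2 : wsum 2 q = 32.
  by rewrite wsum2 nb wsumD !wsumZ w1 wsum0 c1 /q; ring.
suff [] : wsum n.+2 q <= 3 * wsum n.+1 q + 2 * wsum n.+2 (fun _ _ => 1) /\
    wsum n.+1 q <= 2 * n.+1%:R * wsum n.+1 (fun _ _ => 1) by [].
elim: n => [|n [IH1 IH2]]; first by rewrite w1 w2 !c1 !exprS expr0; split; lra.
split; last first.
  move: IH1 IH2; rewrite !c1 !exprS -[n.+2%:R]natr1.
  by set a := 3 ^+ n; set b := n.+1%:R; lra.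
by rewrite wsum_rec nb wsumD !wsumZ; move: IH1; rewrite !c1 !exprS; lra.
Qed.

End WordSums.

(** * Sine estimates and finite Fourier analysis *)

Section Trigonometry.
Variable R : realType.
Implicit Types (x y : R) (d j m : nat) (z : int).

Lemma sin_mean_value x : 0 < x -> exists2 c, 0 < c < x & sin x = x * cos c.
Proof.
move=> x0.
have cs : {within `[0, x], continuous (@sin R)}.
  by apply: continuous_subspaceT => y; exact: continuous_sin.
have [c cx] := MVT x0 (fun y _ => is_derive_sin y) cs.
by rewrite sin0 !subr0 mulrC => e; exists c.
Qed.

Lemma sin_le x : 0 <= x -> sin x <= x.
Proof.
rewrite le_eqVlt => /predU1P[<-|x0]; first by rewrite sin0.
have [c _ ->] := sin_mean_value x0.
by rewrite ger_pMr// cos_le1.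
Qed.

Lemma mul_cos_le_sin x : 0 <= x <= pi -> x * cos x <= sin x.
Proof.
move=> /andP[]; rewrite le_eqVlt => /predU1P[<-|x0] xpi; first by rewrite sin0 mul0r.
have [c /andP[c0 cx] ->] := sin_mean_value x0.
rewrite ler_pM2l// ltW// ltr_cos// in_itv /=; apply/andP; split; lra.
Qed.

(** sin x = 2 sin (x/2) cos (x/2) >= x cos^2 (x/2) = x (1 + cos x) / 2. *)
Lemma sin_ge_half x : 0 <= x <= pi / 2 -> x / 2 <= sin x.
Proof.
move=> /andP[x0 x1]; have pi0 := pi_gt0 R.
have c0 : 0 <= cos x by apply: cos_ge0_pihalf; apply/andP; split; lra.
have h0 : 0 <= cos (x / 2) by apply: cos_ge0_pihalf; apply/andP; split; lra.
have h : x / 2 * cos (x / 2) <= sin (x / 2).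
  by apply: mul_cos_le_sin; apply/andP; split; lra.
have e : x = (x / 2) *+ 2 by rewrite mulr2n; lra.
have ec : cos x = cos (x / 2) ^+ 2 *+ 2 - 1 by rewrite [in LHS]e cos_mulr2n.
have -> : sin x = (cos (x / 2) * sin (x / 2)) *+ 2 by rewrite [in LHS]e sin_mulr2n.
have := ler_wpM2l h0 h.
have : x * 1 <= x * (cos x + 1) by rewrite ler_wpM2l//; lra.
rewrite ec; lra.
Qed.

Lemma sinD_pin x n : sin (x + pi *+ n) = (-1) ^+ n * sin x :> R.
Proof. by rewrite (alternatingn (@sinDpi R)). Qed.

Lemma sin_pi_div_eq0 d m : (0 < d)%N ->
  (sin (pi * m%:R / d%:R) == 0 :> R) = (d %| m)%N.
Proof.
move=> d0; have d0' : 0 < d%:R :> R by rewrite ltr0n.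
rewrite {1}(divn_eq m d) natrD natrM.
have -> : pi * ((m %/ d)%:R * d%:R + (m %% d)%:R) / d%:R =
   pi * (m %% d)%:R / d%:R + pi *+ (m %/ d) :> R.
  by rewrite -[pi *+ _]mulr_natr; field; rewrite gt_eqF.
rewrite sinD_pin mulf_eq0 signr_eq0 /= /dvdn.
have [->|m0] := eqVneq (m %% d)%N 0%N; first by rewrite mulr0 mul0r sin0 eqxx.
apply/negbTE; rewrite gt_eqF// sin_gt0_pi//; apply/andP; split.
  by rewrite divr_gt0// mulr_gt0// ?pi_gt0// ltr0n lt0n.
by rewrite ltr_pdivrMr// ltr_pM2l ?pi_gt0// ltr_nat ltn_mod.
Qed.

(** Multiplication by 2 sin x makes the sum telescope; without division the identity also covers sin
    x = 0. *)
Lemma sum_cos d x : (2 * sin x) * \sum_(j < d) cos (2 * j%:R * x) =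
  sin (2 * d%:R * x - x) + sin x.
Proof.
elim: d => [|d IH]; first by rewrite big_ord0 mulr0 mulr0n mulr0 mul0r sub0r sinN; ring.
rewrite big_ord_recr /= mulrDr IH.
have -> : 2 * d.+1%:R * x - x = 2 * d%:R * x + x by rewrite -natr1; ring.
by set y := 2 * d%:R * x; rewrite [sin (y + x)]sinD [sin (y - x)]sinB; ring.
Qed.

(* Any [e] prime to [d] gives all characters of Z/d. The limit uses [e = 1], the
   upper bound [e = (d + 1) / 2], for which [sin^2 (angle e d j)] equals
   [sin^2 (pi j / d)] and vanishes only at [j = 0]. *)
Definition angle (e d j : nat) : R := 2 * pi * e%:R * j%:R / d%:R.

Lemma sum_cos_angle e d z : (0 < d)%N -> coprime d e ->
  \sum_(j < d) cos (angle e d j * z%:~R) = (d * (d %| `|z|))%:R.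
Proof.
move=> d0 cde; have d0' : d%:R != 0 :> R by rewrite pnatr_eq0 -lt0n.
(* The summands are cos (2 j x), and sin x vanishes exactly when [d] divides [z]. Otherwise 2 d x is
   a multiple of 2 pi, and [sum_cos] gives zero. *)
pose m := (e * `|z|)%N; pose x : R := pi * m%:R / d%:R.
have -> : (d %| `|z|)%N = (sin x == 0) by rewrite /x sin_pi_div_eq0// /m Gauss_dvdr.
have -> : \sum_(j < d) cos (angle e d j * z%:~R) = \sum_(j < d) cos (2 * j%:R * x).
  apply: eq_bigr => j _; rewrite -cos_norm -[RHS]cos_norm; congr cos.
  have -> : `|angle e d j * z%:~R| = `|angle e d j * `|z|%N%:R|.
    by rewrite [LHS]normrM [RHS]normrM natr_absz intr_norm normr_id.
  congr (`| _ |); rewrite /angle /x /m natrM; field.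
  exact: d0'.
case: eqVneq => [x0|x0]; last first.
  rewrite muln0; apply/eqP.
  have : (2 * sin x) * \sum_(j < d) cos (2 * j%:R * x) = 0.
    rewrite sum_cos (_ : _ - x = - x + pi *+ (2 * m)).
      by rewrite sinD_pin exprM sqrrN !expr1n mul1r sinN addNr.
    rewrite -[pi *+ _]mulr_natl natrM /x.
    by generalize (m%:R : R) => M; field; exact: d0'.
  by move/eqP; rewrite !mulf_eq0 pnatr_eq0 (negbTE x0).
rewrite muln1 -[RHS]mulr1 mulr_natl -[in RHS](card_ord d) -sumr_const.
apply: eq_bigr => j _.
have -> : 2 * j%:R * x = (j%:R * x) *+ 2 by rewrite mulr2n; ring.
rewrite cos_mulr2n cos2sin2.
suff -> : sin (j%:R * x) = 0 by rewrite expr0n /= subr0; ring.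
elim: (nat_of_ord j) => [|k IH]; first by rewrite mul0r sin0.
by rewrite -natr1 mulrDl mul1r sinD IH x0 mul0r mulr0 addr0.
Qed.

Definition both_dvd d (x y : int) : bool := (d %| `|x|)%N && (d %| `|y|)%N.

Lemma both_dvd_fourier e d (x y : int) : (0 < d)%N -> coprime d e ->
  (both_dvd d x y)%:R = d%:R ^- 2 *
    \sum_(j < d) \sum_(k < d) character (angle e d j) (angle e d k) x y.
Proof.
move=> d0 cde; have d0' : d%:R != 0 :> R by rewrite pnatr_eq0 -lt0n.
rewrite /character; under eq_bigr do rewrite -mulr_sumr.
rewrite -mulr_suml !sum_cos_angle// /both_dvd -mulnb !natrM.
by field.
Qed.

End Trigonometry.

(** * Equidistribution of the abelianization modulo d *)

Section Equidistribution.
Variable R : realType.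
Implicit Types (h : int -> int -> R) (n d j : nat) (s : R).

(** The mean of [h] at the abelianization of a uniform reduced word of length [n]; [aprob] averages
    it over two consecutive lengths, as in [annular_ratio]. *)
Definition wprob n h : R := wsum n h / wsum n (fun _ _ => 1).

Definition aprob h n : R := 2^-1 * (wprob n.-1 h + wprob n h).

Lemma wprobD n h h' : wprob n (fun x y => h x y + h' x y) = wprob n h + wprob n h'.
Proof. by rewrite /wprob wsumD mulrDl. Qed.

Lemma wprobZ n (c : R) h : wprob n (fun x y => c * h x y) = c * wprob n h.
Proof. by rewrite /wprob wsumZ mulrA. Qed.

Lemma wprob_sum n (I : Type) (r : seq I) (Q : pred I) (h : I -> int -> int -> R) :
  wprob n (fun x y => \sum_(i <- r | Q i) h i x y) = \sum_(i <- r | Q i) wprob n (h i).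
Proof. by rewrite /wprob wsum_sum mulr_suml. Qed.

Lemma wprob_le n h h' : (forall x y, h x y <= h' x y) -> wprob n h <= wprob n h'.
Proof.
by move=> hh; rewrite /wprob ler_pM2r ?invr_gt0 ?wsum_cst_gt0//; exact: wsum_le.
Qed.

Lemma wprob_ext n h h' : (forall x y, h x y = h' x y) -> wprob n h = wprob n h'.
Proof. by move=> hh; rewrite /wprob (wsum_ext _ hh). Qed.

Lemma wprob1 n : wprob n (fun _ _ => 1) = 1.
Proof. by rewrite /wprob divff// gt_eqF// wsum_cst_gt0. Qed.

Lemma wprob_norm_bound n h (b : R) : `|wsum n.+2 h| <= 80 * 3 ^+ n.+2 * b ->
  `|wprob n.+2 h| <= 60 * b.
Proof.
move=> hb; rewrite /wprob normrM normfV (gtr0_norm (wsum_cst_gt0 _ _)).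
rewrite ler_pdivrMr ?wsum_cst_gt0// wsum_cst.
by apply: le_trans hb _; rewrite [3 ^+ n.+2]exprS; lra.
Qed.

(* Telescopes, because the [j]-th summand is at most
   [2 / ((1 + s (j - 1)) (1 + s j))]. *)
Lemma sum_lorentz s d : 0 < s ->
  \sum_(j < d.+1) (1 + s ^+ 2 * j%:R ^+ 2)^-1 <= 1 + 2 / s * (1 - (1 + s * d%:R)^-1).
Proof.
move=> s0; elim: d => [|d IH].
  by rewrite big_ord1 expr0n mulr0 mulr0 addr0 invr1 subrr mulr0 addr0.
rewrite big_ord_recr /=; apply: le_trans (lerD IH (lexx _)) _.
have d0 : 0 <= s * d%:R by rewrite mulr_ge0// ltW.
rewrite -(natr1 d); set u := s * d%:R in d0 *.
have -> : s * (d%:R + 1) = u + s by rewrite /u; ring.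
have e : s ^+ 2 * (d%:R + 1) ^+ 2 = (u + s) ^+ 2 by rewrite /u; ring.
rewrite e -addrA lerD2l.
have p1 : 0 < 1 + u by lra.
have p2 : 0 < 1 + (u + s) by lra.
have p3 : 0 < 1 + (u + s) ^+ 2 by rewrite ltr_pwDl// sqr_ge0.
rewrite -subr_ge0.
have -> : 2 / s * (1 - (1 + (u + s))^-1) - (2 / s * (1 - (1 + u)^-1) + (1 + (u + s) ^+ 2)^-1)
   = (2 * (1 + (u + s) ^+ 2) - (1 + u) * (1 + (u + s))) /
     ((1 + u) * (1 + (u + s)) * (1 + (u + s) ^+ 2)).
  by field; rewrite !gt_eqF.
apply: divr_ge0; last by rewrite !mulr_ge0// ltW.
have := mulr_ge0 d0 (ltW s0); have := sqr_ge0 (1 - (u + s)); nra.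
Qed.

Lemma sum_lorentz_le s d : 0 < s ->
  \sum_(j < d) (1 + s ^+ 2 * j%:R ^+ 2)^-1 <= 1 + 2 / s.
Proof.
move=> s0; case: d => [|d]; first by rewrite big_ord0 addr_ge0// divr_ge0// ltW.
apply: le_trans (sum_lorentz d s0) _; rewrite lerD2l.
rewrite -[leRHS]mulr1 ler_wpM2l ?divr_ge0 ?(ltW s0)//.
by rewrite gerBl invr_ge0 addr_ge0// mulr_ge0// ltW.
Qed.

Lemma sin_angle_half d j : odd d ->
  sin (angle R d.+1./2 d j) ^+ 2 = sin (pi * j%:R / d%:R : R) ^+ 2.
Proof.
move=> od; have d0 : d%:R != 0 :> R by rewrite pnatr_eq0; case: d od.
have -> : angle R d.+1./2 d j = pi * j%:R / d%:R + pi *+ j.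
  have : (2 * d.+1./2 = d.+1)%N by rewrite mul2n even_halfK//= negbK.
  move=> /(congr1 (fun k => k%:R : R)); rewrite natrM -(natr1 d) => e.
  rewrite /angle -[pi *+ j]mulr_natr (_ : 2 * pi * _ = pi * (2 * d.+1./2%:R)); last by ring.
  by rewrite e; field.
by rewrite sinD_pin exprMn sqrr_sign mul1r.
Qed.

Lemma sin_ge_div d j : (j.*2 <= d)%N -> j%:R / d%:R <= sin (pi * j%:R / d%:R : R).
Proof.
move=> jd; case: d jd => [|d] jd.
  by rewrite invr0 !mulr0 sin0.
have d0 : 0 < d.+1%:R :> R by [].
have p2 := pi_ge2 R; have j0 : 0 <= j%:R / d.+1%:R :> R by rewrite divr_ge0.
have j1 : j%:R / d.+1%:R <= 1 / 2 :> R.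
  rewrite ler_pdivrMr// mulrC mulrA ler_pdivlMr// mulr1.
  by rewrite -natrM ler_nat muln2.
rewrite -mulrA; set u := j%:R / _ in j0 j1 *.
have pu : 2 * u <= pi * u by rewrite ler_wpM2r.
have pu2 : pi * u <= pi * (1 / 2) by rewrite ler_wpM2l// pi_ge0.
have := @sin_ge_half R (pi * u); have -> : 0 <= pi * u <= pi / 2 by apply/andP; split; lra.
by move=> /(_ isT); lra.
Qed.

(** Beyond d/2 the symmetry of the sine replaces j by d - j. *)
Lemma sin_sqr_ge d j : (j <= d)%N ->
  (j%:R / d%:R) ^+ 2 <= sin (pi * j%:R / d%:R : R) ^+ 2 \/
  ((d - j)%N%:R / d%:R) ^+ 2 <= sin (pi * j%:R / d%:R : R) ^+ 2.
Proof.
move=> jd; have q0 k : 0 <= k%:R / d%:R :> R by rewrite divr_ge0.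
have [h|h] := leqP j.*2 d; [left | right].
  have := sin_ge_div h => h'; rewrite lerXn2r ?nnegrE//; exact: le_trans h'.
have h2 : ((d - j).*2 <= d)%N by lia.
have := sin_ge_div h2.
have d0 : d%:R != 0 :> R by rewrite pnatr_eq0; lia.
have -> : pi * (d - j)%:R / d%:R = - (pi * j%:R / d%:R) + pi *+ 1 :> R.
  by rewrite natrB// mulr1n; field.
rewrite sinD_pin sinN expr1 mulN1r opprK => h'.
by rewrite lerXn2r ?nnegrE//; exact: le_trans h'.
Qed.

Lemma sum_angle_bound d (N s : R) : odd d -> 0 < s -> 25 * (s * d%:R) ^+ 2 <= N ->
  \sum_(j < d) (1 + N * (sin (angle R d.+1./2 d j) ^+ 2 / 25))^-1 <= 2 * (1 + 2 / s).
Proof.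
move=> od s0 hN; have d0 : 0 < d%:R :> R by rewrite ltr0n; case: d od {hN}.
have N0 : 0 <= N by apply: le_trans hN; apply: mulr_ge0; [exact: ler0n | exact: sqr_ge0].
pose g (k : nat) : R := (1 + s ^+ 2 * k%:R ^+ 2)^-1.
have gp k : 0 < 1 + s ^+ 2 * k%:R ^+ 2 by rewrite ltr_pwDl// mulr_ge0 ?sqr_ge0.
have g0 k : 0 <= g k by rewrite invr_ge0 ltW.
have key k (x : R) : (k%:R / d%:R) ^+ 2 <= x -> (1 + N * (x / 25))^-1 <= g k.
  move=> kx.
  have x0 : 0 <= x by apply: le_trans kx; rewrite sqr_ge0.
  have xp : 0 < 1 + N * (x / 25) by exact: ltr_pwDl ltr01 (mulr_ge0 N0 (divr_ge0 x0 (ler0n _ _))).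
  rewrite lef_pV2 ?posrE//.
  rewrite lerD2l; have := ler_wpM2r x0 hN; have := ler_wpM2l (sqr_ge0 (s * d%:R)) kx.
  rewrite (_ : (s * d%:R) ^+ 2 * (k%:R / d%:R) ^+ 2 = s ^+ 2 * k%:R ^+ 2).
    by lra.
  by field; rewrite gt_eqF.
apply: (@le_trans _ _ (\sum_(j < d) (g j + g (rev_ord j)))).
  apply: ler_sum => j _; rewrite sin_angle_half//.
  have [h|h] := sin_sqr_ge (ltnW (ltn_ord j)).
    by apply: le_trans (key _ _ h) _; rewrite lerDl.
  (* [rev_ord j] is d - j - 1, one less than d - j, which is harmless because [g] decreases. *)
  apply: le_trans (key _ _ h) _; apply: ler_wpDl => //=.
  rewrite lef_pV2 ?posrE//.
  rewrite lerD2l ler_wpM2l ?sqr_ge0// lerXn2r ?nnegrE// ler_nat; lia.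
rewrite big_split mulr_natl mulr2n; apply: lerD; first exact: sum_lorentz_le.
rewrite (reindex_inj rev_ord_inj).
by under eq_bigr do rewrite rev_ordK; exact: sum_lorentz_le.
Qed.

End Equidistribution.

Section EquidistributionLimit.
Variable R : realType.
Implicit Types (h : int -> int -> R) (n d j : nat).

Lemma wprob_both_dvd e n d : (0 < d)%N -> coprime d e ->
  wprob n (fun x y => (both_dvd d x y)%:R : R) = d%:R ^- 2 *
    \sum_(j < d) \sum_(k < d) wprob n (character (angle R e d j) (angle R e d k)).
Proof.
move=> d0 cde; under [in LHS]wprob_ext do rewrite (both_dvd_fourier R _ _ d0 cde).
by rewrite wprobZ wprob_sum; congr (_ * _); apply: eq_bigr => j _; rewrite wprob_sum.
Qed.

(** The point is uniformity in [d], since the sieve uses primes growing with the length. The double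
    sum is at most 60 T^2 for a sum T over one angle, which yields 480 / d^2 + 48000 / (n + 2). *)
Lemma wprob_both_dvd_le n d : odd d ->
  wprob n.+2 (fun x y => (both_dvd d x y)%:R : R) <=
    60 * 800 * (d%:R ^- 2 + n.+2%:R^-1).
Proof.
move=> od; have d0 : (0 < d)%N by case: d od.
have d0' : 0 < d%:R :> R by rewrite ltr0n.
have cde : coprime d d.+1./2.
  have e : d = (d.+1./2 + d.+1./2).-1%N.
    by rewrite addnn even_halfK//= negbK.
  have h0 : (0 < d.+1./2)%N by case: d od {d0 d0' e}.
  rewrite coprime_sym /coprime; apply/eqP.
  have dv : (gcdn d.+1./2 d %| d.+1./2 + d.+1./2)%N.
    by rewrite dvdn_add ?dvdn_gcdl.
  have dv2 : (gcdn d.+1./2 d %| (d.+1./2 + d.+1./2).-1)%N by rewrite -e dvdn_gcdr.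
  apply/eqP; rewrite -dvdn1.
  have -> : (1 = (d.+1./2 + d.+1./2) - (d.+1./2 + d.+1./2).-1)%N by lia.
  by rewrite dvdn_sub.
rewrite (wprob_both_dvd _ d0 cde).
have N0 : 0 < n.+2%:R :> R by rewrite ltr0n.
(* Chosen so that 25 (s d)^2 is exactly n + 2. *)
pose s : R := Num.sqrt n.+2%:R / (5 * d%:R).
have s0 : 0 < s by rewrite divr_gt0 ?sqrtr_gt0// mulr_gt0.
have sd : 25 * (s * d%:R) ^+ 2 <= n.+2%:R.
  have -> : (s * d%:R) ^+ 2 = n.+2%:R / 25.
    rewrite /s; have {2}<- : Num.sqrt n.+2%:R ^+ 2 = n.+2%:R :> R by rewrite sqr_sqrtr ?ltW.
    by field; rewrite gt_eqF.
  lra.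
have hs := sum_angle_bound od s0 sd.
set T := \sum_(j < d) _ in hs.
have T0 : 0 <= T.
  by apply: sumr_ge0 => j _; rewrite invr_ge0 addr_ge0// mulr_ge0// divr_ge0// sqr_ge0.
have h1 : \sum_(j < d) \sum_(k < d)
    wprob n.+2 (character (angle R d.+1./2 d j) (angle R d.+1./2 d k)) <= 60 * (T * T).
  rewrite {1}/T mulr_suml mulr_sumr; apply: ler_sum => j _.
  rewrite /T mulr_sumr mulr_sumr; apply: ler_sum => k _.
  apply: le_trans (ler_norm _) _; apply: wprob_norm_bound.
  exact: wsum_character_decay.
have TT : T * T <= (2 * (1 + 2 / s)) * (2 * (1 + 2 / s)) by exact: ler_pM.
have ss : s ^- 2 = 25 * d%:R ^+ 2 / n.+2%:R.
  rewrite /s; have {2}<- : Num.sqrt n.+2%:R ^+ 2 = n.+2%:R :> R by rewrite sqr_sqrtr ?ltW.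
  by field; rewrite !gt_eqF ?sqrtr_gt0.
have s4 : (1 + 2 / s) ^+ 2 <= 2 + 8 * s ^- 2.
  have := sqr_ge0 (1 - 2 / s); rewrite -exprVn; set v := s^-1; lra.
have h2 : T * T <= 4 * (2 + 8 * (25 * d%:R ^+ 2 / n.+2%:R)).
  by rewrite -ss; apply: le_trans TT _; move: s4; set w := 1 + _; lra.
have d2 : 0 <= d%:R ^- 2 :> R by rewrite invr_ge0 sqr_ge0.
apply: le_trans (ler_wpM2l d2 h1) _.
have : d%:R ^- 2 * (60 * (T * T)) <= d%:R ^- 2 * (60 * (4 * (2 + 8 * (25 * d%:R ^+ 2 / n.+2%:R)))).
  by rewrite ler_wpM2l// ler_wpM2l.
have -> : d%:R ^- 2 * (60 * (4 * (2 + 8 * (25 * d%:R ^+ 2 / n.+2%:R)))) =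
   480 * d%:R ^- 2 + 60 * 800 * n.+2%:R^-1 :> R.
  by field; rewrite !gt_eqF.
move=> h3; apply: le_trans h3 _; rewrite [leRHS]mulrDr lerD2r ler_wpM2r//; lra.
Qed.

Lemma aprob_cvg0 h (C q : R) : 0 <= q < 1 ->
  (forall n, `|aprob h n.+3| <= C * q ^+ n) -> aprob h n @[n --> \oo] --> 0.
Proof.
move=> /andP[q0 q1] hb.
apply/norm_cvg0P; rewrite -(cvg_shiftn 3).
have g0 : geometric C q n @[n --> \oo] --> 0 by apply: cvg_geometric; rewrite ger0_norm.
apply: (@squeeze_cvgr _ _ _ _ (fun _ => 0) _ _ _ _ _ g0); last exact: cvg_cst.
by apply: nearW => n /=; rewrite normr_ge0 addn3 hb.
Qed.

(** If the cosines sum to -2, the mean over the sphere of radius n is (-1)^n, and two consecutive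
    spheres cancel: this is why the annular average is used. Otherwise [rate] is below 1 and each
    sphere decays exponentially. *)
Lemma aprob_character_cvg0 (al be : R) : cos al + cos be != 2 ->
  aprob (character al be) n @[n --> \oo] --> 0.
Proof.
move=> t2; have ca := cos_le1 al; have cb := cos_le1 be.
have ca' := cos_geN1 al; have cb' := cos_geN1 be.
have [tm|tm] := eqVneq (cos al + cos be) (-2).
  apply: (@aprob_cvg0 _ 0 0) => [|n]; first by rewrite lexx ltr01.
  have nb : neighbours (character al be) = fun x y => -4 * character al be x y.
    rewrite neighbours_character tm; apply/funext => x; apply/funext => y; ring.
  have nb1 : neighbours (fun _ _ => 1 : R) = fun _ _ => 4 * 1.
    by apply/funext => x; apply/funext => y; rewrite /neighbours; ring.
  have key m : wsum m.+1 (character al be) = (-1) ^+ m.+1 * wsum m.+1 (fun _ _ => 1) /\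
      wsum m.+2 (character al be) = (-1) ^+ m.+2 * wsum m.+2 (fun _ _ => 1).
    have c0 : character al be 0 0 = 1 by rewrite /character !mulr0 cos0 mulr1.
    elim: m => [|m [IH1 IH2]].
      rewrite !wsum2 !nb !nb1 !wsumZ !wsum1 !wsum0 nb nb1 c0 !exprS expr0; split; ring.
    split=> //; rewrite !wsum_rec nb nb1 !wsumZ IH1 IH2 !exprS; ring.
  rewrite mul0r normr_le0 /aprob /wprob /=.
  have w0 m : wsum m (fun _ _ => 1 : R) != 0 by rewrite gt_eqF// wsum_cst_gt0.
  rewrite (key n.+1).1 (key n.+1).2 !mulfK//.
  by rewrite !exprS (_ : _ + _ = 0) ?mulr0//; ring.
have t4 := cos_sum_le4 al be.
set t := 2 * (cos al + cos be) in t4.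
have r1 : rate t < 1.
  have : (cos al + cos be - 2) * (cos al + cos be + 2) < 0.
    rewrite nmulr_rlt0; last by rewrite subr_lt0 lt_neqAle t2; lra.
    by rewrite -(opprK 2) subr_gt0 lt_neqAle eq_sym tm; lra.
  rewrite /rate /t; lra.
have /andP[r0 r1'] := rate_bounds t4.
have b n : `|wprob n.+2 (character al be)| <= 60 * rate t ^+ n.+2.
  apply: wprob_norm_bound; apply: le_trans (wsum_character_bound _ _ _) _.
  by rewrite exprMn mulrA.
apply: (@aprob_cvg0 _ 60 (rate t)); first by rewrite r1 andbT; lra.
move=> n; rewrite /aprob /= normrM ger0_norm//.
have rn m : rate t ^+ (n + m) <= rate t ^+ n.
  rewrite exprD -[leRHS]mulr1 ler_wpM2l ?exprn_ge0 ?exprn_ile1//; lra.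
have := b n; have := b n.+1; have := rn 2%N; have := rn 3%N; rewrite addn2 addn3.
have := ler_normD (wprob n.+2 (character al be)) (wprob n.+3 (character al be)).
lra.
Qed.

(** Among the d^2 characters only the trivial one, j = k = 0, contributes in the limit. *)
Lemma aprob_both_dvd_cvg d : (0 < d)%N ->
  aprob (fun x y => (both_dvd d x y)%:R : R) n @[n --> \oo] --> (d%:R ^- 2 : R).
Proof.
move=> d0; pose c j k : int -> int -> R := character (angle R 1 d j) (angle R 1 d k).
have -> : aprob (fun x y => (both_dvd d x y)%:R : R) =
    fun n => d%:R ^- 2 * \sum_(j < d) \sum_(k < d) aprob (c j k) n.
  apply/funext => n; rewrite /aprob !(@wprob_both_dvd 1) ?coprimen1//.
  rewrite -mulrDr mulrCA -big_split /=; congr (_ * _); rewrite mulr_sumr.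
  by apply: eq_bigr => j _; rewrite -big_split mulr_sumr.
rewrite -[X in _ --> X]mulr1.
apply: cvgMl_tmp.
have -> : (1 : R) = \sum_(j < d) \sum_(k < d) ((j == 0%N :> nat) && (k == 0%N :> nat))%:R.
  rewrite (bigD1 (Ordinal d0))//= [X in _ + X]big1 => [|j j0].
    rewrite addr0 (bigD1 (Ordinal d0))//= big1 ?addr0// => k k0.
    by rewrite -[(k == 0 :> nat)%N]/(k == Ordinal d0) (negbTE k0).
  by apply: big1 => k _; rewrite -[(j == 0 :> nat)%N]/(j == Ordinal d0) (negbTE j0).
apply: cvg_big => [|j _]; first exact: add_continuous.
apply: cvg_big => [|k _]; first exact: add_continuous.
have [/andP[/eqP j0 /eqP k0]|jk] := boolP ((j == 0%N :> nat) && (k == 0%N :> nat)).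
  have -> : aprob (c j k) = fun=> 1.
    have c1 x y : c j k x y = 1.
      by rewrite /c /character /angle j0 k0 !mulr0 !mul0r cos0 mulr1.
    apply/funext => n; rewrite /aprob !(wprob_ext _ c1) !wprob1; lra.
  exact: cvg_cst.
apply: aprob_character_cvg0.
have small (i : 'I_d) : i != 0%N :> nat -> cos (angle R 1 d i) != 1.
  move=> i0.
  have -> : angle R 1 d i = (pi * i%:R / d%:R) *+ 2 by rewrite /angle mulr2n; lra.
  rewrite cos_mulr2n cos2sin2.
  have : sin (pi * i%:R / d%:R : R) != 0.
    by rewrite sin_pi_div_eq0// gtnNdvd// lt0n.
  set u := sin _; rewrite -sqrf_eq0; apply: contra => /eqP; lra.
have cj := cos_le1 (angle R 1 d j); have ck := cos_le1 (angle R 1 d k).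
move: jk; rewrite negb_and => /orP[/small|/small]; apply: contra => /eqP ?; apply/eqP; lra.
Qed.

End EquidistributionLimit.

(** * The Basel problem and the Euler product *)

Section Basel.
Variable R : realType.
Implicit Types (n k N : nat).

Definition odd_angle n k : R := pi * k.*2.+1%:R / (2 ^ n.+2)%:R.

Lemma pow2_gt0 n : 0 < (2 ^ n)%:R :> R.
Proof. by rewrite ltr0n expn_gt0. Qed.

Lemma odd_angle_bounds n k : (k < 2 ^ n)%N -> 0 < odd_angle n k < pi / 2.
Proof.
move=> kn; rewrite /odd_angle; apply/andP; split.
  by rewrite divr_gt0 ?pow2_gt0// mulr_gt0 ?pi_gt0// ltr0n.
rewrite ltr_pdivrMr ?pow2_gt0// -mulrA ltr_pM2l ?pi_gt0//.
rewrite mulrC ltr_pdivlMr// -natrM ltr_nat !expnS; lia.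
Qed.

Lemma sin_odd_angle_gt0 n k : (k < 2 ^ n)%N -> 0 < sin (odd_angle n k).
Proof.
move=> /odd_angle_bounds/andP[h0 h1].
by apply: sin_gt0_pihalf; rewrite h0.
Qed.

(* Pairing [k] with [2 ^ n.+1 - 1 - k], this is the identity
   [1 / sin^2 (x / 2) + 1 / cos^2 (x / 2) = 4 / sin^2 x]. *)
Lemma sum_inv_sin_sqr n : \sum_(k < 2 ^ n) (sin (odd_angle n k)) ^- 2 = 2 * 4 ^+ n.
Proof.
elim: n => [|n IH].
  rewrite expn0 big_ord1 /odd_angle expr0 mulr1 mulr1.
  have -> : (2 ^ 2)%:R = 4 :> R by [].
  have e : (pi / 4) *+ 2 = pi / 2 :> R by rewrite mulr2n; lra.
  have := sin_mulr2n (pi / 4 : R); rewrite e sin_pihalf.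
  have := cos2Dsin2 (pi / 4 : R); have := cos_mulr2n (pi / 4 : R).
  rewrite e cos_pihalf => h1 h2 _.
  have -> : sin (pi / 4) ^+ 2 = 2^-1 :> R by lra.
  by rewrite invrK.
have e2 : (2 ^ n.+1 = 2 ^ n + 2 ^ n)%N by rewrite expnS mul2n addnn.
rewrite e2 big_split_ord /= [X in _ + X](reindex_inj rev_ord_inj) /= -big_split /=.
rewrite exprS mulrCA -IH mulr_sumr; apply: eq_bigr => k _.
have kn := ltn_ord k; have s0 := sin_odd_angle_gt0 kn.
set x := odd_angle n k in s0 *.
have ex : odd_angle n.+1 k = x / 2.
  rewrite /x /odd_angle [in LHS]expnS natrM; field.
  by rewrite gt_eqF// pow2_gt0.
have ex' : odd_angle n.+1 (2 ^ n + (2 ^ n - k.+1)) = - (x / 2) + pi / 2.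
  rewrite -ex /odd_angle.
  have -> : ((2 ^ n + (2 ^ n - k.+1)).*2.+1 = 2 ^ n.+2 - k.*2.+1)%N by rewrite !expnS; lia.
  rewrite natrB; last by rewrite !expnS; lia.
  have -> : (2 ^ n.+3)%:R = 2 * (2 ^ n.+2)%:R :> R by rewrite [in LHS]expnS natrM.
  by field; rewrite gt_eqF// pow2_gt0.
rewrite ex ex' sinDpihalf cosN.
have e : x = (x / 2) *+ 2 by rewrite mulr2n; lra.
have := sin_mulr2n (x / 2); rewrite -e => sx.
have := cos2Dsin2 (x / 2) => cs.
have sx' : sin x = 2 * (cos (x / 2) * sin (x / 2)) by rewrite sx mulr_natl.
have ne : cos (x / 2) * sin (x / 2) != 0.
  by apply/negP => /eqP h; move: s0; rewrite sx' h mulr0 ltxx.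
move: ne; rewrite mulf_eq0 negb_or => /andP[nc ns].
rewrite sx'; transitivity
  ((cos (x / 2) ^+ 2 + sin (x / 2) ^+ 2) / (cos (x / 2) * sin (x / 2)) ^+ 2).
  by field; rewrite nc ns.
by rewrite cs; field; rewrite nc ns.
Qed.

(** The lower bound is cot^2 x, so this says sin x <= x <= tan x. *)
Lemma inv_sin_sqr_bounds (x : R) : 0 < x < pi / 2 -> sin x ^- 2 - 1 <= x ^- 2 <= sin x ^- 2.
Proof.
move=> /andP[x0 x1]; have s0 : 0 < sin x by apply: sin_gt0_pihalf; rewrite x0.
have pi0 := pi_gt0 R.
apply/andP; split; last first.
  rewrite lef_pV2 ?posrE ?exprn_gt0// lerXn2r ?nnegrE ?(ltW x0) ?(ltW s0)//.
  exact/sin_le/ltW.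
have c0 : 0 <= cos x by apply: cos_ge0_pihalf; apply/andP; split; lra.
have h : x * cos x <= sin x by apply: mul_cos_le_sin; apply/andP; split; lra.
have -> : sin x ^- 2 - 1 = cos x ^+ 2 / sin x ^+ 2.
  by rewrite cos2sin2; field; rewrite gt_eqF.
rewrite ler_pdivrMr ?exprn_gt0// mulrC ler_pdivlMr ?exprn_gt0//.
rewrite -exprMn mulrC lerXn2r ?nnegrE ?mulr_ge0 ?(ltW x0) ?(ltW s0)//.
Qed.

Definition odd_sum N : R := \sum_(k < N) k.*2.+1%:R ^- 2.

(** Each of the 2^n terms 1/x^2 differs from 1/sin^2 x by at most 1, which after scaling by 4^-n is
    an error of order 2^-n. *)
Lemma odd_sum_pow2 n :
  pi ^+ 2 / 8 - pi ^+ 2 / 16 * (2 ^ n)%:R^-1 <= odd_sum (2 ^ n) <= pi ^+ 2 / 8.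
Proof.
have e : odd_sum (2 ^ n) = pi ^+ 2 / (16 * 4 ^+ n) * \sum_(k < 2 ^ n) (odd_angle n k) ^- 2.
  rewrite mulr_sumr; apply: eq_bigr => k _; rewrite /odd_angle.
  have -> : (2 ^ n.+2)%:R = 4 * (2 ^ n)%:R :> R by rewrite !expnS mulnA natrM.
  have -> : 4 ^+ n = (2 ^ n)%:R ^+ 2 :> R.
    by rewrite natrX -exprM mulnC exprM; congr (_ ^+ _); ring.
  have h1 : k.*2.+1%:R != 0 :> R by rewrite pnatr_eq0.
  have h2 : pi != 0 :> R by rewrite gt_eqF// pi_gt0.
  have h3 : (2 ^ n)%:R != 0 :> R by rewrite gt_eqF// pow2_gt0.
  move: h1 h2 h3; move: (k.*2.+1%:R : R) (pi : R) ((2 ^ n)%:R : R) => a b c h1 h2 h3.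
  by field; rewrite h1 h2 h3.
have c0 : 0 < pi ^+ 2 / (16 * 4 ^+ n) :> R.
  by rewrite divr_gt0 ?mulr_gt0 ?exprn_gt0 ?pi_gt0.
have p4 : 4 ^+ n != 0 :> R by rewrite gt_eqF// exprn_gt0.
have b k : (k < 2 ^ n)%N -> sin (odd_angle n k) ^- 2 - 1 <= odd_angle n k ^- 2
    <= sin (odd_angle n k) ^- 2.
  by move=> /odd_angle_bounds; exact: inv_sin_sqr_bounds.
rewrite e; apply/andP; split; last first.
  have -> : pi ^+ 2 / 8 = pi ^+ 2 / (16 * 4 ^+ n) * (2 * 4 ^+ n) :> R by field.
  rewrite ler_pM2l// -sum_inv_sin_sqr; apply: ler_sum => k _.
  by have /andP[] := b k (ltn_ord k).
have -> : pi ^+ 2 / 8 - pi ^+ 2 / 16 / (2 ^ n)%:R =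
   pi ^+ 2 / (16 * 4 ^+ n) * (2 * 4 ^+ n - (2 ^ n)%:R) :> R.
  have -> : 4 ^+ n = (2 ^ n)%:R ^+ 2 :> R.
    by rewrite natrX -exprM mulnC exprM; congr (_ ^+ _); ring.
  by field; rewrite gt_eqF ?pow2_gt0.
rewrite ler_pM2l// -sum_inv_sin_sqr.
have -> : (2 ^ n)%:R = \sum_(k < 2 ^ n) (1 : R) by rewrite sumr_const card_ord.
rewrite -sumrB; apply: ler_sum => k _.
by have /andP[] := b k (ltn_ord k).
Qed.

Lemma odd_sum_pow2_cvg : odd_sum (2 ^ n) @[n --> \oo] --> pi ^+ 2 / 8.
Proof.
have h : pi ^+ 2 / 8 - pi ^+ 2 / 16 * (2 ^ n)%:R^-1 @[n --> \oo] --> (pi ^+ 2 / 8 : R).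
  rewrite -[X in _ --> X]subr0 -[X in _ - X](mulr0 (pi ^+ 2 / 16)).
  apply: cvgB; first exact: cvg_cst.
  apply: cvgMl_tmp.
  have -> : (fun n => (2 ^ n)%:R^-1 : R) = (fun n => 2^-1 ^+ n).
    by apply/funext => n; rewrite natrX exprVn.
  by apply: cvg_expr; rewrite ger0_norm//; lra.
apply: (squeeze_cvgr _ h (cvg_cst _)).
by apply: nearW => n; exact: odd_sum_pow2.
Qed.

End Basel.

(** * Partial Euler products *)

Section EulerProduct.
Variable R : realType.
Implicit Types (n k N p d : nat) (l : seq nat).

Definition coprime_to l n : bool := all (fun p => ~~ (p %| n)%N) l.

Definition sq_sum l N : R := \sum_(1 <= n < N.+1 | coprime_to l n) n%:R ^- 2.

Lemma sq_sumS l N : sq_sum l N.+1 =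
  sq_sum l N + (if coprime_to l N.+1 then N.+1%:R ^- 2 else 0).
Proof.
by rewrite /sq_sum big_mkcond big_nat_recr//= -big_mkcond.
Qed.

Lemma sq_sum0 l : sq_sum l 0 = 0.
Proof. by rewrite /sq_sum big_geq. Qed.

Lemma coprime_to_mul l p n : prime p -> all prime l -> p \notin l ->
  coprime_to l (p * n) = coprime_to l n.
Proof.
move=> pp; elim: l => //= q l IH /andP[pq pl]; rewrite inE negb_or => /andP[neq nl].
by rewrite IH// Euclid_dvdM// dvdn_prime2// eq_sym (negbTE neq).
Qed.

(** The multiples of [p] that are removed form a copy, scaled by p^-2, of the sum up to N / p: the
    Euler factor at [p] for finite sums. *)
Lemma sq_sum_cons p l N : prime p -> all prime l -> p \notin l ->
  sq_sum (p :: l) N = sq_sum l N - p%:R ^- 2 * sq_sum l (N %/ p).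
Proof.
move=> pp pl nl; have p0 := prime_gt0 pp.
elim: N => [|N IH]; first by rewrite div0n !sq_sum0 mulr0 subr0.
rewrite !sq_sumS IH divnS//=; have [pN|pN] /= := boolP (p %| N.+1)%N; last first.
  by rewrite add0n; ring.
have e : N.+1 = (p * (N %/ p).+1)%N.
  by rewrite -{1}(divnK pN) divnS// pN add1n mulnC.
have hc : coprime_to l N.+1 = coprime_to l (N %/ p).+1 by rewrite {1}e coprime_to_mul.
have hr : N.+1%:R = p%:R * (N %/ p).+1%:R :> R by rewrite {1}e natrM.
rewrite add1n sq_sumS hc; case: ifP => _; last by rewrite !addr0.
rewrite hr exprMn [(_ ^+ 2 * _ ^+ 2)^-1]invfM mulrDr addr0.
by rewrite opprD addrACA subrr addr0.
Qed.

Lemma sq_sum_nil_le N : sq_sum [::] N.+1 <= 2 - N.+1%:R^-1.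
Proof.
elim: N => [|N IH]; first by rewrite sq_sumS sq_sum0 /= expr1n invr1; lra.
rewrite sq_sumS /=; apply: le_trans (lerD IH (lexx _)) _.
have n0 : 0 < N.+1%:R :> R by [].
rewrite -(natr1 N.+1); move: (N.+1%:R : R) n0 => x x0.
rewrite -subr_ge0.
have -> : 2 - (x + 1)^-1 - (2 - x^-1 + (x + 1) ^- 2) = (x * (x + 1) ^+ 2)^-1.
  by field; rewrite !gt_eqF//; lra.
by rewrite invr_ge0 mulr_ge0 ?(ltW x0) ?sqr_ge0.
Qed.

Lemma sq_sum_nondecreasing l : nondecreasing_seq (sq_sum l).
Proof.
apply/nondecreasing_seqP => N; rewrite sq_sumS lerDl.
by case: ifP => // _; rewrite invr_ge0 sqr_ge0.
Qed.

Lemma sq_sum_nil_cvg : cvgn (sq_sum [::]).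
Proof.
apply: nondecreasing_is_cvgn; first exact: sq_sum_nondecreasing.
exists 2 => _ [[|N] _ <-]; first by rewrite sq_sum0.
apply: le_trans (sq_sum_nil_le N) _; rewrite gerBl invr_ge0//.
Qed.

Definition euler l : R := \prod_(p <- l) (1 - p%:R ^- 2).

Lemma sq_sum_cvg (L : R) l : sq_sum [::] n @[n --> \oo] --> L ->
  all prime l -> uniq l -> sq_sum l n @[n --> \oo] --> (L * euler l).
Proof.
move=> hL; elim: l => [|p l IH] /=; first by rewrite /euler big_nil mulr1.
move=> /andP[pp pl] /andP[nl ul].
have -> : sq_sum (p :: l) = fun N => sq_sum l N - p%:R ^- 2 * sq_sum l (N %/ p).
  by apply/funext => N; exact: sq_sum_cons.
have -> : L * euler (p :: l) = L * euler l - p%:R ^- 2 * (L * euler l).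
  by rewrite /euler big_cons; ring.
have hl := IH pl ul.
apply: cvgB => //; apply: cvgMl_tmp.
apply: cvg_comp hl; apply: cvg_divnr; exact: prime_gt0.
Qed.

Lemma sq_sum_2 N : sq_sum [:: 2%N] N.*2 = odd_sum R N.
Proof.
elim: N => [|N IH]; first by rewrite sq_sum0 /odd_sum big_ord0.
rewrite doubleS !sq_sumS IH /odd_sum big_ord_recr /=.
by rewrite !dvdn2 /= odd_double /= addr0.
Qed.

(** The odd terms make up 3/4 of the whole sum L, and along powers of two they tend to pi^2 / 8. *)
Lemma basel : sq_sum [::] n @[n --> \oo] --> (pi ^+ 2 / 6 : R).
Proof.
have hL := sq_sum_nil_cvg; set L := lim _ in hL.
have h2 := sq_sum_cvg hL (isT : all prime [:: 2%N]) isT.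
have h3 : odd_sum R (2 ^ n) @[n --> \oo] --> L * euler [:: 2%N].
  have -> : (fun n => odd_sum R (2 ^ n)) = sq_sum [:: 2%N] \o (fun n => (2 ^ n).*2).
    by apply/funext => n /=; rewrite sq_sum_2.
  apply: cvg_comp h2; apply/cvgnyPge => A; near=> n.
  apply: (@leq_trans n); first by near: n; exact: nbhs_infty_ge.
  by rewrite -addnn; apply: leq_trans (leq_addr _ _); rewrite ltnW// ltn_expl.
have := cvg_unique _ h3 (@odd_sum_pow2_cvg R).
rewrite /euler big_seq1 => e.
suff <- : L = pi ^+ 2 / 6 by [].
have : L * (1 - 2 ^- 2) = pi ^+ 2 / 8 by exact: e.
lra.
Unshelve. all: by end_near. Qed.

Definition primes_upto z := [seq p <- iota 1 z | prime p].

Lemma primes_upto_prime z : all prime (primes_upto z).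
Proof. exact: filter_all. Qed.

Lemma primes_upto_uniq z : uniq (primes_upto z).
Proof. by rewrite filter_uniq// iota_uniq. Qed.

Lemma mem_primes_upto z p : (p \in primes_upto z) = prime p && (p <= z)%N.
Proof.
rewrite mem_filter mem_iota; case: (boolP (prime p)) => //= pp.
by rewrite (prime_gt0 pp) add1n ltnS.
Qed.

Lemma coprime_to_primes_upto z n : (1 < n)%N -> coprime_to (primes_upto z) n -> (z < n)%N.
Proof.
move=> n1 /allP h; rewrite ltnNge; apply/negP => nz.
have := h (pdiv n); rewrite mem_primes_upto pdiv_prime// pdiv_dvd.
by rewrite (leq_trans (dvdn_leq (ltnW n1) (pdiv_dvd n)) nz) => /(_ isT).
Qed.

(** Apart from n = 1, only numbers exceeding z + 1 survive, and their inverse squares telescope. *)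
Lemma sq_sum_upto_bounds z N : 1 <= sq_sum (primes_upto z.+1) N.+1 <= 1 + z.+1%:R^-1.
Proof.
have c1 : coprime_to (primes_upto z.+1) 1.
  apply/allP => p; rewrite mem_primes_upto => /andP[pp _].
  by rewrite dvdn1; apply: contraTN pp => /eqP ->.
have h1 : sq_sum (primes_upto z.+1) 1 = 1 by rewrite sq_sumS sq_sum0 c1 expr1n invr1 add0r.
apply/andP; split.
  by rewrite -{1}h1; apply: sq_sum_nondecreasing.
(* The maximum keeps the bound equal to 1 while N <= z, where n = 1 is the only term. *)
suff : sq_sum (primes_upto z.+1) N.+1 <= 1 + z.+1%:R^-1 - (maxn z N).+1%:R^-1.
  by move=> /le_trans; apply; rewrite gerBl invr_ge0.
elim: N => [|N IH].
  by rewrite h1 maxn0 addrK.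
rewrite sq_sumS; case: ifP => [cN|_]; last first.
  rewrite addr0; apply: le_trans IH _; rewrite lerD2l lerN2 lef_pV2 ?posrE//.
  by rewrite ler_nat; lia.
have zN : (z.+1 < N.+2)%N by exact: coprime_to_primes_upto cN.
have -> : maxn z N.+1 = N.+1 by lia.
have e : maxn z N = N by lia.
rewrite e in IH; apply: le_trans (lerD IH (lexx _)) _.
have n0 : 0 < N.+1%:R :> R by [].
rewrite -(natr1 N.+1); move: (N.+1%:R : R) n0 => x x0.
rewrite -!addrA lerD2l lerD2l -subr_ge0.
have -> : - (x + 1)^-1 - (- x^-1 + (x + 1) ^- 2) = (x * (x + 1) ^+ 2)^-1.
  by field; rewrite !gt_eqF//; lra.
by rewrite invr_ge0 mulr_ge0 ?(ltW x0) ?sqr_ge0.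
Qed.

Lemma euler_bounds z :
  6 / pi ^+ 2 <= euler (primes_upto z.+1) <= 6 / pi ^+ 2 * (1 + z.+1%:R^-1).
Proof.
have h := sq_sum_cvg basel (primes_upto_prime z.+1) (primes_upto_uniq z.+1).
have p2 : 0 < pi ^+ 2 :> R by rewrite exprn_gt0// pi_gt0.
have key n : (0 < n)%N -> 1 <= sq_sum (primes_upto z.+1) n <= 1 + z.+1%:R^-1.
  by case: n => // n _; exact: sq_sum_upto_bounds.
have b : 1 <= pi ^+ 2 / 6 * euler (primes_upto z.+1) <= 1 + z.+1%:R^-1.
  apply/andP; split.
    apply: (cvgr_to_ge h); near=> n; suff /key/andP[] : (0 < n)%N by [].
    by near: n; exact: nbhs_infty_gt.
  apply: (cvgr_to_le h); near=> n; suff /key/andP[] : (0 < n)%N by [].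
  by near: n; exact: nbhs_infty_gt.
move: p2 b; set E := euler _; move: (pi ^+ 2 : R) => q q0 /andP[b1 b2].
have c0 : 0 < 6 / q by rewrite divr_gt0.
have -> : E = 6 / q * (q / 6 * E) by field; rewrite gt_eqF.
by rewrite ler_pM2l// b2 andbT ler_peMr// ltW.
Unshelve. all: by end_near. Qed.

Lemma pi_sqr_gt6 : 6 < pi ^+ 2 :> R.
Proof.
have h : 5 / 4 <= pi ^+ 2 / 6 :> R.
  apply: (cvgr_to_ge basel); near=> n.
  apply: le_trans (_ : sq_sum [::] 2 <= _); last first.
    by apply: sq_sum_nondecreasing; near: n; exact: nbhs_infty_ge.
  by rewrite !sq_sumS sq_sum0 /= expr1n; lra.
lra.
Unshelve. all: by end_near. Qed.

End EulerProduct.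

(** * Density of the visible elements *)

Section Sieve.
Variable R : realType.
Implicit Types (n d p z B : nat) (l : seq nat) (x y : int) (P Q : int -> int -> bool).

Definition ind P x y : R := (P x y)%:R.

Lemma ind_le P Q n : (forall x y, P x y -> Q x y) -> wprob n (ind P) <= wprob n (ind Q).
Proof.
move=> h; apply: wprob_le => x y; rewrite /ind; have := h x y.
by case: (P x y) => [/(_ isT) ->|_]; rewrite ?ler_nat.
Qed.

Lemma aprobD (h h' : int -> int -> R) n :
  aprob (fun x y => h x y + h' x y) n = aprob h n + aprob h' n.
Proof. by rewrite /aprob !wprobD; ring. Qed.

Lemma aprobZ (c : R) (h : int -> int -> R) n :
  aprob (fun x y => c * h x y) n = c * aprob h n.
Proof. by rewrite /aprob !wprobZ; ring. Qed.

Definition sieve l d x y := both_dvd d x y && all (fun p => ~~ both_dvd p x y) l.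

Lemma both_dvdM d p x y : coprime d p ->
  both_dvd (d * p) x y = both_dvd d x y && both_dvd p x y.
Proof. by move=> c; rewrite /both_dvd !Gauss_dvd// andbACA. Qed.

Lemma sieve_cons p l d : coprime d p ->
  ind (sieve (p :: l) d) = fun x y => ind (sieve l d) x y + -1 * ind (sieve l (d * p)) x y.
Proof.
move=> c; apply/funext => x; apply/funext => y; rewrite /ind /sieve both_dvdM//=.
by case: (both_dvd d x y); case: (both_dvd p x y); case: (all _ _); rewrite /=; ring.
Qed.

(** Inclusion-exclusion, one prime at a time; [d] carries the product of the primes already imposed
    as divisors. *)
Lemma sieve_cvg l d : (0 < d)%N -> all prime l -> uniq l ->
  all (coprime d) l -> aprob (ind (sieve l d)) n @[n --> \oo] --> d%:R ^- 2 * euler R l.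
Proof.
elim: l d => [|p l IH] d d0 /=.
  move=> _ _ _; rewrite /euler big_nil mulr1.
  have -> : ind (sieve [::] d) = fun x y => (both_dvd d x y)%:R.
    by apply/funext => x; apply/funext => y; rewrite /ind /sieve andbT.
  exact: aprob_both_dvd_cvg.
move=> /andP[pp pl] /andP[nl ul] /andP[cp cl].
have p0 := prime_gt0 pp.
rewrite sieve_cons//.
have -> : aprob (fun x y => ind (sieve l d) x y + -1 * ind (sieve l (d * p)) x y) =
    fun n => aprob (ind (sieve l d)) n + -1 * aprob (ind (sieve l (d * p))) n.
  by apply/funext => n; rewrite aprobD aprobZ.
have -> : d%:R ^- 2 * euler R (p :: l) =
    d%:R ^- 2 * euler R l + -1 * ((d * p)%:R ^- 2 * euler R l).
  rewrite /euler big_cons natrM exprMn [(_ ^+ 2 * _ ^+ 2)^-1]invfM.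
  by move: (_ ^- 2) (_ ^- 2) => a b; ring.
apply: cvgD; first exact: IH.
apply: cvgMl_tmp; apply: IH => //; first by rewrite muln_gt0 d0.
apply/allP => q ql; rewrite coprimeMl (allP cl)//= prime_coprime//.
rewrite dvdn_prime2// ?(allP pl)//.
by apply: contraNneq nl => ->.
Qed.

Definition coprimez_abs x y := coprime `|x| `|y|.

Lemma coprime_sieve z x y : coprimez_abs x y -> sieve (primes_upto z) 1 x y.
Proof.
move=> c; rewrite /sieve /both_dvd !dvd1n /=; apply/allP => p.
rewrite mem_primes_upto => /andP[pp _]; apply/negP => /andP[px py].
have : (p %| gcdn `|x| `|y|)%N by rewrite dvdn_gcd px.
by rewrite (eqP c) dvdn1 => /eqP p1; rewrite p1 in pp.
Qed.

(** A sieved pair that is not coprime has a common prime factor above [z], odd since z >= 2. If it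
    exceeds [B], so does the absolute value of a nonzero coordinate. *)
Lemma sieve_not_coprime z B x y : (2 <= z)%N ->
  sieve (primes_upto z) 1 x y -> ~~ coprimez_abs x y ->
  [exists p : 'I_B.+1, [&& (z < p)%N, odd p & both_dvd p x y]] \/
  B%:R ^+ 2 <= x%:~R ^+ 2 + y%:~R ^+ 2 :> R.
Proof.
move=> z2 /andP[_ /allP hs] nc.
pose g := gcdn `|x| `|y|.
have hp p : prime p -> (p %| g)%N -> both_dvd p x y by move=> _; rewrite dvdn_gcd.
have big p : prime p -> (p %| g)%N -> (z < p)%N.
  move=> pp pg; rewrite ltnNge; apply/negP => pz.
  have := hs p; rewrite mem_primes_upto pp pz => /(_ isT).
  by rewrite hp.
(* The pair (0, 0) is divisible by 2 and hence was sieved out. *)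
have g0 : (0 < g)%N.
  rewrite lt0n; apply/negP => /eqP g0.
  by have := big 2%N isT; rewrite g0 dvdn0 => /(_ isT); rewrite ltnNge z2.
have g1 : (1 < g)%N.
  by move: nc g0; rewrite /coprimez_abs /coprime -/g; lia.
have pp := pdiv_prime g1; have pg := pdiv_dvd g; set p := pdiv g in pp pg.
have zp := big _ pp pg; have pxy := hp _ pp pg.
have op : odd p.
  by case: (even_prime pp) => // p2; move: zp; rewrite p2 ltnNge z2.
have [pB|pB] := leqP p B; [left | right].
  by apply/existsP; exists (Ordinal (pB : (p < B.+1)%N)); rewrite /= zp op pxy.
have sq (w : int) : `|w|%:R ^+ 2 = w%:~R ^+ 2 :> R.
  by rewrite -[RHS]real_normK ?num_real// -intr_norm natr_absz.
rewrite -!sq; case/andP: pxy => px py.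
have le w : (0 < w)%N -> (p %| w)%N -> B%:R ^+ 2 <= w%:R ^+ 2 :> R.
  move=> w0 pw; rewrite lerXn2r ?nnegrE// ler_nat.
  exact: leq_trans (ltnW pB) (dvdn_leq w0 pw).
have := g0; rewrite gcdn_gt0 => /orP[h|h].
  by apply: le_trans (le _ h px) _; rewrite lerDl sqr_ge0.
by apply: le_trans (le _ h py) _; rewrite lerDr sqr_ge0.
Qed.

Lemma sieve_le_coprime z B x y : (2 <= z)%N -> (0 < B)%N ->
  ind (sieve (primes_upto z) 1) x y <= ind coprimez_abs x y +
    (\sum_(p < B.+1 | (z < p)%N && odd p) (both_dvd p x y)%:R +
     B%:R ^- 2 * (x%:~R ^+ 2 + y%:~R ^+ 2)).
Proof.
move=> z2 B0; have s0 : 0 <= B%:R ^- 2 * (x%:~R ^+ 2 + y%:~R ^+ 2) :> R.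
  by rewrite mulr_ge0 ?invr_ge0 ?addr_ge0 ?sqr_ge0.
have s1 : 0 <= \sum_(p < B.+1 | (z < p)%N && odd p) (both_dvd p x y)%:R :> R.
  by apply: sumr_ge0.
rewrite /ind; case: (boolP (sieve _ _ x y)) => [hs|_]; last by rewrite !addr_ge0.
case: (boolP (coprimez_abs x y)) => [_|nc]; first by rewrite lerDl addr_ge0.
rewrite add0r; have [/existsP[p /and3P[zp op pxy]]|h] := sieve_not_coprime B z2 hs nc.
  rewrite (bigD1 p) ?zp//= pxy -addrA lerDl addr_ge0//.
  by apply: sumr_ge0.
apply: ler_wpDl => //; rewrite mulrC ler_pdivlMr ?mul1r//.
by rewrite exprn_gt0// ltr0n.
Qed.

Definition tail_cst : R := 60 * 800.

Lemma tail_cst_ge0 : 0 <= tail_cst.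
Proof. exact: mulr_ge0 (ler0n _ _) (ler0n _ _). Qed.

Lemma sum_inv_sqr_tail z B : (0 < z)%N ->
  \sum_(p < B.+1 | (z < p)%N) p%:R ^- 2 <= z%:R^-1 - (maxn z B)%:R^-1 :> R.
Proof.
move=> z0; rewrite big_mkcond; elim: B => [|B IH].
  by rewrite big_ord_recr big_ord0 /= maxn0 subrr addr0.
rewrite big_ord_recr /= [maxn z B.+1]/maxn.
have [zB|zB] := ltnP z B.+1; last first.
  have e : maxn z B = z by lia.
  by rewrite e in IH; rewrite addr0.
have e : maxn z B = B by lia.
rewrite e in IH.
apply: le_trans (lerD IH (lexx _)) _; rewrite -addrA lerD2l.
have : 0 < B%:R :> R by rewrite ltr0n (leq_trans z0).
rewrite -(natr1 B); move: (B%:R : R) => w w0; rewrite -subr_ge0.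
have -> : - (w + 1)^-1 - (- w^-1 + (w + 1) ^- 2) = (w * (w + 1) ^+ 2)^-1.
  by field; rewrite !gt_eqF//; lra.
by rewrite invr_ge0 mulr_ge0 ?(ltW w0) ?sqr_ge0.
Qed.

(** Primes from [z] to [B] are controlled by the uniform divisibility bound, larger ones by the
    second moment and Markov's inequality. *)
Lemma wprob_sieve_le z B n : (2 <= z)%N -> (0 < B)%N ->
  wprob n.+2 (ind (sieve (primes_upto z) 1)) <= wprob n.+2 (ind coprimez_abs) +
    (tail_cst * (z%:R^-1 + B.+1%:R / n.+2%:R) + B%:R ^- 2 * (2 * n.+2%:R)).
Proof.
move=> z2 B0.
apply: le_trans (wprob_le _ (fun x y => sieve_le_coprime x y z2 B0)) _.
rewrite wprobD lerD2l wprobD wprobZ wprob_sum.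
have B2 : 0 <= B%:R ^- 2 :> R by rewrite invr_ge0 sqr_ge0.
apply: lerD; last first.
  rewrite ler_wpM2l// /wprob ler_pdivrMr ?wsum_cst_gt0//.
  exact: wsum_sqr.
apply: (@le_trans _ _ (\sum_(p < B.+1 | (z < p)%N && odd p)
    tail_cst * (p%:R ^- 2 + n.+2%:R^-1))).
  by apply: ler_sum => p /andP[_ op]; exact: wprob_both_dvd_le.
have t0 := tail_cst_ge0.
have q0 (p : nat) : 0 <= p%:R ^- 2 + n.+2%:R^-1 :> R.
  by rewrite addr_ge0 ?invr_ge0 ?sqr_ge0.
rewrite -mulr_sumr ler_wpM2l//.
apply: (@le_trans _ _ (\sum_(p < B.+1 | (z < p)%N) (p%:R ^- 2 + n.+2%:R^-1))).
  rewrite [leLHS]big_mkcondr; apply: ler_sum => p _.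
  by case: ifP.
rewrite big_split; apply: lerD => /=.
  apply: le_trans (sum_inv_sqr_tail _ _) _; first exact: ltnW.
  by rewrite gerBl invr_ge0.
rewrite big_mkcond /=; apply: (@le_trans _ _ (\sum_(p < B.+1) n.+2%:R^-1)).
  by apply: ler_sum => p _; case: ifP => //; rewrite invr_ge0.
by rewrite sumr_const card_ord mulr_natl.
Qed.

Lemma nat_sqrt_ex n : exists m, (m ^ 2 <= n < m.+1 ^ 2)%N.
Proof.
elim: n => [|n [m /andP[h1 h2]]]; first by exists 0%N.
have [h|h] := ltnP n.+1 (m.+1 ^ 2); first by exists m; rewrite h ltnW.
exists m.+1; rewrite h; apply: leq_ltn_trans h2 _; by rewrite ltn_exp2r.
Qed.

Lemma wprob_sieve_eventually z : (2 <= z)%N -> \forall n \near \oo,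
  wprob n (ind (sieve (primes_upto z) 1)) <=
    wprob n (ind coprimez_abs) + (2 * tail_cst + 2) * z%:R^-1.
Proof.
move=> z2.
suff key n : (((3 * z) * z).+2 ^ 2 <= n)%N -> wprob n (ind (sieve (primes_upto z) 1)) <=
    wprob n (ind coprimez_abs) + (2 * tail_cst + 2) * z%:R^-1.
  by near=> n; apply: key; near: n; exact: nbhs_infty_ge.
move=> n0.
have [m /andP[m1 m2]] := nat_sqrt_ex n.
have mz : ((3 * z) * z < m)%N.
  have := leq_ltn_trans n0 m2; rewrite ltn_exp2r//; lia.
have z0 : (0 < z)%N by lia.
have n2 : (2 <= n)%N by apply: leq_trans n0; rewrite -[leqLHS]muln1 expnS leq_mul//.
case: n n2 n0 m1 m2 => [//|[//|n]] _ n0 m1 m2.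
(* With m the integer square root of n, the choice B = z (m + 1) makes (B + 1) / n at most 1/z, as m
   > 3 z^2, and n / B^2 at most 1/z^2. *)
have B0 : (0 < z * m.+1)%N by rewrite muln_gt0 z0.
apply: le_trans (wprob_sieve_le n z2 B0) _; rewrite lerD2l.
have zr : 0 < z%:R :> R by rewrite ltr0n.
have nr : 0 < n.+2%:R :> R by rewrite ltr0n.
have mr : 0 < m.+1%:R :> R by rewrite ltr0n.
have b1 : (z * m.+1).+1%:R / n.+2%:R <= z%:R^-1 :> R.
  rewrite ler_pdivrMr// mulrC ler_pdivlMr// -natrM ler_nat.
  apply: leq_trans m1; rewrite expnS expn1; nia.
have b2 : (z * m.+1)%:R ^- 2 * (2 * n.+2%:R) <= 2 * z%:R^-1 :> R.
  rewrite natrM exprMn [(_ ^+ 2 * _ ^+ 2)^-1]invfM mulrCA -mulrA.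
  rewrite ler_pM2l// -[leRHS]mulr1.
  apply: ler_pM; rewrite ?invr_ge0 ?sqr_ge0 ?mulr_ge0 ?invr_ge0 ?sqr_ge0//.
    by rewrite lef_pV2 ?posrE ?exprn_gt0// -natrX ler_nat expnS expn1 leq_pmulr.
  by rewrite mulrC ler_pdivrMr ?exprn_gt0// mul1r -natrX ler_nat ltnW.
have t0 := tail_cst_ge0.
have b3 := ler_wpM2l t0 b1.
rewrite [leRHS]mulrDl mulrDr; apply: lerD b2.
apply: le_trans (lerD (lexx _) b3) _.
by rewrite -[2 * _ * _]mulrA [leRHS]mulr_natl mulr2n.
Unshelve. all: by end_near. Qed.

(** The sieve by the primes up to [z] overestimates the coprime pairs by O(1/z) for large n, and its
    limit is within O(1/z) of 6 / pi^2. *)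
Lemma aprob_coprime_cvg : aprob (ind coprimez_abs) n @[n --> \oo] --> 6 / pi ^+ 2.
Proof.
apply/cvgrPdist_le => e e0.
pose C : R := 2 * tail_cst + 2; pose D : R := 6 / pi ^+ 2.
have C0 : 0 <= C by exact: addr_ge0 (mulr_ge0 (ler0n _ _) tail_cst_ge0) (ler0n _ _).
have D0 : 0 <= D by rewrite divr_ge0// sqr_ge0.
have [z [z2 zC zD]] : exists z, [/\ (2 <= z)%N, C * z%:R^-1 <= e / 2 & D * z%:R^-1 <= e / 2].
  have k0 : 0 < e / 2 by lra.
  pose z := (Num.truncn ((C + D) / (e / 2))).+2; exists z.
  have zz : 0 < z%:R :> R by rewrite ltr0n.
  have h : C + D <= e / 2 * z%:R.
    rewrite mulrC -ler_pdivrMr// ltW//; apply: lt_trans (truncnS_gt _) _.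
    by rewrite ltr_nat.
  by split=> //; rewrite ler_pdivrMr//; lra.
have hs : aprob (ind (sieve (primes_upto z) 1)) n @[n --> \oo] --> euler R (primes_upto z).
  have := @sieve_cvg (primes_upto z) 1 isT (primes_upto_prime z) (primes_upto_uniq z).
  rewrite expr1n invr1 mul1r; apply; apply/allP => p _; exact: coprime1n.
have [E1 E2] : D <= euler R (primes_upto z) /\ euler R (primes_upto z) <= D + e / 2.
  have := euler_bounds R z.-1; rewrite prednK ?(leq_trans _ z2)// -/D.
  by rewrite mulrDr mulr1 => /andP[h1 h2]; split=> //; lra.
move/cvgrPdist_le: hs => /(_ (e / 2)) hs.
case: (wprob_sieve_eventually z2) => N _ hN.
near=> n.
have w1 : wprob n (ind (sieve (primes_upto z) 1)) <=
    wprob n (ind coprimez_abs) + C * z%:R^-1.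
  by apply: hN; near: n; exact: nbhs_infty_ge.
have w2 : wprob n.-1 (ind (sieve (primes_upto z) 1)) <=
    wprob n.-1 (ind coprimez_abs) + C * z%:R^-1.
  by apply: hN; near: n; exists N.+1 => // k /=; case: k.
have u m : wprob m (ind coprimez_abs) <= wprob m (ind (sieve (primes_upto z) 1)).
  by apply: ind_le => x y; exact: coprime_sieve.
have : `|euler R (primes_upto z) - aprob (ind (sieve (primes_upto z) 1)) n| <= e / 2.
  by near: n; apply: hs; lra.
have := u n; have := u n.-1; rewrite -/D !ler_norml /aprob => ? ? /andP[? ?].
apply/andP; split; lra.
Unshelve. all: by end_near. Qed.

End Sieve.

(** * Counting in spheres and balls *)

Section SphereCount.
Local Notation X := (fintype_ordinal__canonical__choice_Choice 2).
Local Notation F := (freegroup X).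
Implicit Types (S : set (freegroup 'I_2)) (n : nat).

Definition words n : seq F := pmap insub (rwords n).

Lemma words_uniq n : uniq (words n).
Proof. exact/pmap_sub_uniq/rwords_uniq. Qed.

Lemma mem_words n (w : F) : (w \in words n) = (flen w == n).
Proof. by rewrite mem_pmap_sub mem_rwords (fwordP w). Qed.

Lemma map_words n : [seq fword w | w <- words n] = rwords n.
Proof.
rewrite (pmap_filter (insubK _)); apply/all_filterP/allP => s.
by rewrite mem_rwords => /andP[rs _]; rewrite /= insubT.
Qed.

Lemma card_fset_set_words (A S : set (freegroup 'I_2)) (s : seq F) :
  uniq s -> (forall w, A w <-> w \in s /\ S w) ->
  #|` fset_set A| = count (fun w => `[< S w >]) s.
Proof.
move=> us h; rewrite -size_filter.
have u : uniq [seq w <- s | `[< S w >]] by rewrite filter_uniq.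
rewrite -[in RHS](undup_id u) -card_fseq; congr (#|` _|).
have fA : finite_set A.
  apply: (@sub_finite_set _ _ [set w : freegroup 'I_2 | w \in s]); last exact: finite_seq.
  by move=> w /h[].
apply/fsetP => w; rewrite in_fset_set// inE mem_filter; apply/idP/idP.
  by rewrite inE => /h[-> /asboolP ->].
by case/andP => /asboolP Sw ws; rewrite inE; apply/h.
Qed.

Lemma sphere_cardE n S : sphere_card n S = count (fun w => `[< S w >]) (words n).
Proof.
apply: card_fset_set_words; first exact: words_uniq.
by move=> w; rewrite mem_words; split=> -[h1 h2]; split=> //; apply/eqP.
Qed.

Lemma sphere_card_le n S S' : S `<=` S' -> (sphere_card n S <= sphere_card n S')%N.
Proof.
move=> h; rewrite !sphere_cardE; apply: sub_count => w /asboolP Sw.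
by apply/asboolP; exact: h.
Qed.

Lemma sphere_card_leU n S S' S'' : S `<=` S' `|` S'' ->
  (sphere_card n S <= sphere_card n S' + sphere_card n S'')%N.
Proof.
move=> h; rewrite !sphere_cardE -count_predUI; apply: leq_trans (leq_addr _ _).
by apply: sub_count => w /asboolP/h [] Sw; apply/orP; [left | right]; apply/asboolP.
Qed.

Lemma sphere_card_setT n : sphere_card n [set: freegroup 'I_2] = size (rwords n).
Proof.
rewrite sphere_cardE -map_words size_map -count_predT.
by apply: eq_count => w; apply/asboolP.
Qed.

Lemma sphere_cardC n S :
  (sphere_card n S + sphere_card n (~` S) = size (rwords n))%N.
Proof.
rewrite -map_words size_map !sphere_cardE -(count_predC (fun w => `[< S w >])).
by congr addn; apply: eq_count => w /=; exact: asbool_neg.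
Qed.

End SphereCount.

(** * Proper powers are rare *)

Section ProperPowers.
Local Notation X := (fintype_ordinal__canonical__choice_Choice 2).
Local Notation L := (X * bool)%type.
Local Notation F := (freegroup X).
Variable R : realType.

Definition short_words n : seq (seq L) := flatten [seq rwords m | m <- iota 0 n].

Lemma short_wordsS n : short_words n.+1 = short_words n ++ rwords n.
Proof. by rewrite /short_words -(addn1 n) iotaD map_cat flatten_cat /= cats0. Qed.

Lemma size_short_words n : (size (short_words n.+1) <= 2 * 3 ^ n)%N.
Proof.
suff h : (size (short_words n.+1)).+1 = (2 * 3 ^ n)%N by rewrite -h.
elim: n => [//|n IH].
by rewrite short_wordsS size_cat -addSn IH size_rwords expnS; lia.
Qed.

Lemma mem_short_words n s : (s \in short_words n) = reduced s && (size s < n)%N.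
Proof.
elim: n => [|n IH]; first by rewrite andbF.
rewrite short_wordsS mem_cat IH mem_rwords -andb_orr; congr andb.
by rewrite [in RHS]ltnS [in RHS]leq_eqVlt [RHS]orbC.
Qed.

(* A proper power [c r^k c^-1] is determined by its length, its prefix [c r],
   which is at most half of it, and the length of [c]. *)
Definition power_of_prefix n (i : nat) (s : seq L) : seq L :=
  let r := drop i s in
  take i s ++ flatten (nseq ((n - i.*2) %/ size r) r) ++ winv (take i s).

Lemma proper_power_prefix n (w : F) : proper_power w -> flen w = n.+1 ->
  fword w \in [seq power_of_prefix n.+1 i s | i <- iota 0 n.+1, s <- short_words n.+1./2.+1].
Proof.
case=> u [k [k2 ->]]; have [->|u1] := eqVneq u 1%g; first by rewrite expg1n.
have [c [r [r0 e hk]]] := power_decomposition u1.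
rewrite /flen hk; last by lia.
have sf j : size (flatten (nseq j r)) = (j * size r)%N.
  by elim: j => //= j IH; rewrite size_cat IH mulSn.
have sc : size (winv c) = size c by rewrite /winv size_rev size_map.
rewrite !size_cat sf sc => sn.
have rs : (0 < size r)%N by rewrite lt0n size_eq0.
have rcr : reduced (c ++ r).
  by have := fwordP u; rewrite e catA reduced_cat => /and3P[].
have -> : c ++ flatten (nseq k r) ++ winv c = power_of_prefix n.+1 (size c) (c ++ r).
  rewrite /power_of_prefix take_size_cat// drop_size_cat//.
  by rewrite -sn (_ : _ - _ = k * size r)%N ?mulnK//; lia.
apply: allpairs_f; first by rewrite mem_iota; nia.
have kr : (2 * size r <= k * size r)%N by rewrite leq_mul2r k2 orbT.
rewrite mem_short_words rcr size_cat.
by move: kr sn; clear; move: (k * size r)%N (size c) (size r) => A C Q; lia.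
Qed.

Lemma sphere_card_proper_power n :
  (sphere_card n.+1 [set w : freegroup 'I_2 | proper_power w] <=
   n.+1 * (2 * 3 ^ n.+1./2))%N.
Proof.
rewrite sphere_cardE -size_filter -(size_map (@fword X)).
apply: (@leq_trans (size [seq power_of_prefix n.+1 i s | i <- iota 0 n.+1,
   s <- short_words n.+1./2.+1])).
  apply: uniq_leq_size.
    rewrite map_inj_in_uniq ?filter_uniq ?words_uniq// => u v _ _; exact: val_inj.
  move=> s /mapP[w]; rewrite mem_filter mem_words => /andP[/asboolP pw /eqP wn] ->.
  exact: proper_power_prefix.
rewrite size_allpairs size_iota leq_mul2l size_short_words orbT//.
Qed.

Lemma sqr_le_pow3 m : (m.+1 ^ 2 <= 2 * 3 ^ m)%N.
Proof.
elim: m => [//|[//|m] IH].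
by rewrite expnS; move: IH; rewrite !expnS !expn0; lia.
Qed.

(** The share of order n 3^(-n/2) is weakened to order 1/n by comparing squares with powers of 3. *)
Lemma proper_power_ratio n :
  sphere_ratio R [set w : freegroup 'I_2 | proper_power w] n.+1 <= 12 / n.+2%:R.
Proof.
rewrite /sphere_ratio sphere_card_setT size_rwords.
rewrite ler_pdivrMr ?ltr0n ?muln_gt0 ?expn_gt0//.
rewrite mulrAC ler_pdivlMr ?ltr0n// -!natrM ler_nat.
apply: leq_trans (leq_mul (sphere_card_proper_power n) (leqnn _)) _.
have := sqr_le_pow3 (uphalf n.+1).
have : (3 * 3 ^ n = 3 ^ n.+1./2 * 3 ^ uphalf n.+1)%N.
  by rewrite -expnS -expnD; congr (3 ^ _)%N; lia.
have : (n.+1 <= 2 * uphalf n.+1)%N by lia.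
move: (uphalf n.+1) (3 ^ n.+1./2)%N (3 ^ n)%N => m a b h1 h2 h3.
have h4 : (n.+1 * n.+2 <= 4 * m.+1 ^ 2)%N.
  by rewrite (_ : 4 * _ = (2 * m.+1) * (2 * m.+1))%N ?leq_mul; lia.
have h5 : (4 * m.+1 ^ 2 <= 8 * 3 ^ m)%N by lia.
have h6 := leq_mul (leq_trans h4 h5) (leqnn (2 * a)%N).
rewrite (_ : n.+1 * (2 * a) * n.+2 = n.+1 * n.+2 * (2 * a))%N; last by lia.
apply: leq_trans h6 _; rewrite (_ : 8 * 3 ^ m * (2 * a) = 16 * (a * 3 ^ m))%N; last by lia.
by rewrite -h2; lia.
Qed.

End ProperPowers.

(** * From spheres to balls *)

Section BallCount.
Local Notation X := (fintype_ordinal__canonical__choice_Choice 2).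
Local Notation F := (freegroup X).
Variable R : realType.
Implicit Types (S : set (freegroup 'I_2)) (n : nat).

Lemma short_words_uniq n : uniq (short_words n).
Proof.
elim: n => [//|n IH]; rewrite short_wordsS cat_uniq IH rwords_uniq andbT /=.
apply/hasPn => s; rewrite mem_rwords mem_short_words => /andP[_ /eqP ->].
by rewrite ltnn andbF.
Qed.

Lemma ball_cardE n S :
  ball_card n S = count (fun w => `[< S w >]) (pmap insub (short_words n.+1) : seq F).
Proof.
apply: card_fset_set_words; first exact/pmap_sub_uniq/short_words_uniq.
move=> w; rewrite mem_pmap_sub mem_short_words (fwordP w) ltnS /=.
by split=> -[h1 h2]; split.
Qed.

Lemma ball_cardS n S : ball_card n.+1 S = (ball_card n S + sphere_card n.+1 S)%N.
Proof. by rewrite !ball_cardE short_wordsS pmap_cat count_cat sphere_cardE. Qed.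

Lemma ball_card_setT n : ball_card n [set: freegroup 'I_2] = (2 * 3 ^ n).-1.
Proof.
elim: n => [|n IH].
  rewrite ball_cardE short_wordsS (_ : short_words 0 = [::])// cat0s.
  by rewrite -/(words 0) -sphere_cardE sphere_card_setT.
rewrite ball_cardS IH sphere_card_setT size_rwords expnS.
by have := expn_gt0 3 n; lia.
Qed.

Lemma ball_cardC n S :
  (ball_card n S + ball_card n (~` S) = ball_card n [set: freegroup 'I_2])%N.
Proof.
rewrite !ball_cardE; set s := pmap _ _.
have -> : count (fun w => `[< [set: freegroup 'I_2] w >]) s = size s.
  by rewrite -count_predT; apply: eq_count => w; apply/asboolP.
rewrite -(count_predC (fun w => `[< S w >])); congr addn.
by apply: eq_count => w /=; exact: asbool_neg.
Qed.

Lemma ball_ratioC n S : ball_ratio R S n = 1 - ball_ratio R (~` S) n.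
Proof.
have h : (ball_card n [set: freegroup 'I_2])%:R != 0 :> R.
  by rewrite ball_card_setT pnatr_eq0; have := expn_gt0 3 n; lia.
have e : (ball_card n S)%:R = (ball_card n [set: freegroup 'I_2])%:R - (ball_card n (~` S))%:R :> R.
  by rewrite -(ball_cardC n S) natrD addrK.
by rewrite /ball_ratio e mulrBl divff.
Qed.

Lemma ball_ratio_bounds n S : 0 <= ball_ratio R S n <= 1.
Proof.
have h m S' : 0 <= ball_ratio R S' m by rewrite /ball_ratio divr_ge0.
by rewrite h ball_ratioC gerBl h.
Qed.

(* Only the two outermost spheres of the ball are counted. *)
Lemma annular_le_ball n S : 4 / 9 * annular_ratio R S n.+2 <= ball_ratio R S n.+2.
Proof.
rewrite /annular_ratio /ball_ratio /sphere_ratio /= !sphere_card_setT !size_rwords.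
rewrite ball_card_setT.
set a := sphere_card n.+1 S; set b := sphere_card n.+2 S.
have p0 : 0 < (3 ^ n)%:R :> R by rewrite ltr0n expn_gt0.
have b0 : 0 < ((2 * 3 ^ n.+2).-1)%:R :> R.
  by rewrite ltr0n !expnS; have := expn_gt0 3 n; lia.
have ab : (a + b <= ball_card n.+2 S)%N by rewrite !ball_cardS -/a -/b; lia.
rewrite ler_pdivlMr//; apply: (@le_trans _ _ (a + b)%:R); last by rewrite ler_nat.
have b1 : ((2 * 3 ^ n.+2).-1)%:R <= 18 * (3 ^ n)%:R :> R.
  by rewrite -natrM ler_nat !expnS; lia.
have c0 : 0 <= a%:R / (4 * (3 ^ n)%:R) + b%:R / (12 * (3 ^ n)%:R) :> R.
  by apply: addr_ge0; apply: divr_ge0 => //; apply: mulr_ge0.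
have -> : (4 * 3 ^ n.+1)%:R = 12 * (3 ^ n)%:R :> R by rewrite expnS mulnA natrM.
have -> : (4 * 3 ^ n)%:R = 4 * (3 ^ n)%:R :> R by rewrite natrM.
apply: (@le_trans _ _ (4 / 9 * (2^-1 * (a%:R / (4 * (3 ^ n)%:R) + b%:R / (12 * (3 ^ n)%:R)))
   * (18 * (3 ^ n)%:R))).
  by rewrite ler_wpM2l// mulr_ge0// mulr_ge0.
(* The constant 4/9 is the one that gives the inner sphere coefficient exactly 1; the outer one gets
   1/3. *)
rewrite (_ : _ * _ = a%:R + 3^-1 * b%:R); last by field; rewrite gt_eqF.
by rewrite natrD lerD2l; have : 0 <= b%:R :> R by []; lra.
Qed.

End BallCount.

(** * Comparison of lower and upper limits with convergent sequences *)

Section LimInfSup.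
Variable R : realType.
Variable u : nat -> R.
Hypothesis u01 : forall n, 0 <= u n <= 1.

Let u_ub : has_ubound (range u).
Proof. by exists 1 => _ [n _ <-]; have /andP[] := u01 n. Qed.

Let u_lb : has_lbound (range u).
Proof. by exists 0 => _ [n _ <-]; have /andP[] := u01 n. Qed.

Lemma limn_inf_le_limn_sup : limn_inf u <= limn_sup u.
Proof.
have hs := cvg_sups_inf u_ub u_lb; have hi := cvg_infs_sup u_ub u_lb.
apply: ler_lim; [exact: cvgP hi | exact: cvgP hs |].
apply: nearW => n; apply: (@le_trans _ _ (u n)).
  by apply: ge_inf; [exact: has_lbound_sdrop u_lb _ | exists n => /=].
by apply: ub_le_sup; [exact: has_ubound_sdrop u_ub _ | exists n => /=].
Qed.

Lemma le_limn_inf (v : nat -> R) (l : R) : v n @[n --> \oo] --> l ->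
  (\forall n \near \oo, v n <= u n) -> l <= limn_inf u.
Proof.
move=> vl vu; have hi := cvg_infs_sup u_ub u_lb.
apply/ler_addgt0Pl => e e0; rewrite -lerBlDl; apply: limr_ge; first exact: cvgP hi.
have [N _ hN] : \forall n \near \oo, l - e <= u n.
  move/cvgrPdist_le : vl => /(_ _ e0) vl; near=> n.
  apply: (@le_trans _ _ (v n)); last by near: n.
  have : `|l - v n| <= e by near: n.
  by rewrite ler_norml => /andP[]; lra.
exists N => // n /= Nn; apply: lb_le_inf; first by exists (u n), n => /=.
by move=> _ [m /= nm <-]; apply: hN; exact: leq_trans nm.
Unshelve. all: by end_near. Qed.

Lemma limn_sup_le (v : nat -> R) (l : R) : v n @[n --> \oo] --> l ->
  (\forall n \near \oo, u n <= v n) -> limn_sup u <= l.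
Proof.
move=> vl vu; have hs := cvg_sups_inf u_ub u_lb.
apply/ler_addgt0Pl => e e0; apply: limr_le; first exact: cvgP hs.
have [N _ hN] : \forall n \near \oo, u n <= e + l.
  move/cvgrPdist_le : vl => /(_ _ e0) vl; near=> n.
  apply: (@le_trans _ _ (v n)); first by near: n.
  have : `|l - v n| <= e by near: n.
  by rewrite ler_norml => /andP[]; lra.
exists N => // n /= Nn; apply: ge_sup; first by exists (u n), n => /=.
by move=> _ [m /= nm <-]; apply: hN; exact: leq_trans nm.
Unshelve. all: by end_near. Qed.

End LimInfSup.

(** * Densities of the test elements *)

Section TestDensity.
Variable R : realType.

Definition visible_set : set (freegroup 'I_2) := [set w | visible w].
Definition power_set : set (freegroup 'I_2) := [set w | proper_power w].

Lemma sphere_ratio_visible n :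
  sphere_ratio R visible_set n = wprob n (ind R coprimez_abs).
Proof.
rewrite /sphere_ratio /wprob wsum_size sphere_card_setT; congr (_ / _).
rewrite sphere_cardE /wsum -map_words big_map -sum1_count natr_sum big_mkcond /=.
apply: eq_bigr => w _; rewrite /ind -[coprimez_abs _ _]/(visible w).
by rewrite asboolb; case: (visible w).
Qed.

Lemma sphere_ratioC n (S : set (freegroup 'I_2)) :
  sphere_ratio R S n = 1 - sphere_ratio R (~` S) n.
Proof.
have h : (sphere_card n [set: freegroup 'I_2])%:R != 0 :> R.
  by rewrite sphere_card_setT -wsum_size gt_eqF// wsum_cst_gt0.
have e : (sphere_card n S)%:R =
    (sphere_card n [set: freegroup 'I_2])%:R - (sphere_card n (~` S))%:R :> R.
  by rewrite sphere_card_setT -(sphere_cardC n S) natrD addrK.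
by rewrite /sphere_ratio e mulrBl divff.
Qed.

(** The non-test elements contain the visible ones and lie in their union with the proper powers. *)
Lemma sphere_ratio_test n :
  wprob n (ind R coprimez_abs) <= sphere_ratio R (~` test_elements (freegroup 'I_2)) n
    <= wprob n (ind R coprimez_abs) + sphere_ratio R power_set n.
Proof.
rewrite -sphere_ratio_visible /sphere_ratio -mulrDl -natrD.
have c0 : 0 <= (sphere_card n [set: freegroup 'I_2])%:R^-1 :> R by rewrite invr_ge0.
rewrite !ler_wpM2r ?ler_nat//.
  by apply: sphere_card_leU => w /non_test_visible_or_power.
by apply: sphere_card_le => w; exact: visible_not_test.
Qed.

Lemma annular_ratioC n (S : set (freegroup 'I_2)) :
  annular_ratio R S n = 1 - annular_ratio R (~` S) n.
Proof. by rewrite /annular_ratio !(sphere_ratioC _ S); lra. Qed.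

Lemma annular_power_cvg : annular_ratio R power_set n @[n --> \oo] --> 0.
Proof.
rewrite -(cvg_shiftn 2).
have h : 12 * harmonic n @[n --> \oo] --> (0 : R).
  by rewrite -[X in _ --> X](mulr0 12); apply: cvgMl_tmp; exact: cvg_harmonic.
apply: (squeeze_cvgr _ (cvg_cst 0) h); apply: nearW => n /=; rewrite addn2.
have g0 m : 0 <= sphere_ratio R power_set m by rewrite divr_ge0.
have le m : (n < m)%N -> sphere_ratio R power_set m <= 12 * n.+1%:R^-1.
  case: m => // m nm; apply: le_trans (proper_power_ratio R m) _.
  by rewrite ler_wpM2l// lef_pV2 ?posrE// ler_nat ltnW.
rewrite /annular_ratio /= mulr_ge0 ?addr_ge0//=.
apply: (@le_trans _ _ (12 / n.+1%:R)); last exact: lexx.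
move: (le n.+1 (leqnn _)) (le n.+2 (leqnSn _)).
move: (sphere_ratio R _ n.+1) (sphere_ratio R _ n.+2) (12 / n.+1%:R) => a b c; lra.
Qed.

Lemma annular_non_test_cvg :
  annular_ratio R (~` test_elements (freegroup 'I_2)) n @[n --> \oo] --> 6 / pi ^+ 2.
Proof.
have h1 := @aprob_coprime_cvg R.
have h2 : aprob (ind R coprimez_abs) n + annular_ratio R power_set n @[n --> \oo]
    --> 6 / pi ^+ 2.
  by rewrite -[X in _ --> X]addr0; apply: cvgD; [exact: h1 | exact: annular_power_cvg].
apply: (squeeze_cvgr _ h1 h2); apply: nearW => n.
have /andP[a1 a2] := sphere_ratio_test n; have /andP[b1 b2] := sphere_ratio_test n.-1.
by rewrite /annular_ratio /aprob; apply/andP; split; lra.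
Qed.

Lemma annular_test_cvg :
  annular_ratio R (test_elements (freegroup 'I_2)) n @[n --> \oo] --> 1 - 6 / pi ^+ 2.
Proof.
have -> : annular_ratio R (test_elements (freegroup 'I_2)) =
    fun n => 1 - annular_ratio R (~` test_elements (freegroup 'I_2)) n.
  by apply/funext => n; exact: annular_ratioC.
by apply: cvgB; [exact: cvg_cst | exact: annular_non_test_cvg].
Qed.

Lemma annular_le_ball_near (S : set (freegroup 'I_2)) :
  \forall n \near \oo, 4 / 9 * annular_ratio R S n <= ball_ratio R S n.
Proof.
by exists 2%N => // n /= n2; case: n n2 => [//|[//|n]] _; exact: annular_le_ball.
Qed.

End TestDensity.

Theorem theorem4 (R : realType) :
  has_strict_annular_density
    (test_elements (freegroup 'I_2)) (1 - 6 / (pi : R) ^+ 2) /\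
  [/\ 0 < 4 / 9 * (1 - 6 / (pi : R) ^+ 2),
      4 / 9 * (1 - 6 / (pi : R) ^+ 2) <=
        limn_inf (ball_ratio R (test_elements (freegroup 'I_2))),
      limn_inf (ball_ratio R (test_elements (freegroup 'I_2))) <=
        limn_sup (ball_ratio R (test_elements (freegroup 'I_2))),
      limn_sup (ball_ratio R (test_elements (freegroup 'I_2))) <=
        1 - 8 / (3 * (pi : R) ^+ 2) &
      1 - 8 / (3 * (pi : R) ^+ 2) < 1].
Proof.
have p6 := pi_sqr_gt6 R; have p0 : 0 < (pi : R) ^+ 2 by lra.
have bb n : 0 <= ball_ratio R (test_elements (freegroup 'I_2)) n <= 1.
  exact: ball_ratio_bounds.
split; first exact: annular_test_cvg.
split.
- by rewrite mulr_gt0// subr_gt0 ltr_pdivrMr// mul1r.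
- have h : 4 / 9 * annular_ratio R (test_elements (freegroup 'I_2)) n @[n --> \oo]
      --> 4 / 9 * (1 - 6 / (pi : R) ^+ 2).
    by apply: cvgMl_tmp; exact: annular_test_cvg.
  by have := @le_limn_inf R _ bb _ _ h; apply; exact: annular_le_ball_near.
- exact: limn_inf_le_limn_sup.
(* The upper bound is the lower bound for the complement, whose annular density is 6 / pi^2. *)
- have h : 1 - 4 / 9 * annular_ratio R (~` test_elements (freegroup 'I_2)) n @[n --> \oo]
      --> 1 - 8 / (3 * (pi : R) ^+ 2).
    have -> : 8 / (3 * (pi : R) ^+ 2) = 4 / 9 * (6 / (pi : R) ^+ 2).
      by move: p0; move: ((pi : R) ^+ 2) => q q0; field; rewrite gt_eqF.
    apply: cvgB; first exact: cvg_cst.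
    by apply: cvgMl_tmp; exact: annular_non_test_cvg.
  apply: (limn_sup_le bb h).
  have [N _ hN] := annular_le_ball_near R (~` test_elements (freegroup 'I_2)).
  by exists N => // n /hN hn; rewrite ball_ratioC lerB.
- by rewrite ltrBlDr ltrDl divr_gt0// mulr_gt0.
Qed.
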